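(* Assume $G$ is semisimple of adjoint type. The morphism $$\tau:R_T^\wedge\otimes_{(R_T^\wedge)^W}R_T^\wedge\to \mathrm{Fun}(W,R_T^\wedge),\qquad a\otimes b\mapsto\big(w\mapsto a\cdot w^{-1}(b)\big)$$ is injective, and its image consists exactly of the functions $f:W\to R_T^\wedge$ such that $f(w)\equiv f(ws_{\alpha^\vee})\pmod{1-e^{\alpha^\vee}}$ for every $w\in W$ and every coroot $\alpha^\vee$ (with $s_{\alpha^\vee}$ the associated reflection).
   Context: $G$ complex semisimple adjoint, $T$ maximal torus, $W$ Weyl group, $\Bbbk$ any field. $R_T=\Bbbk[X_*(T)]$ with basis $e^\lambda$; $R_T^\wedge$ its completion at the augmentation ideal; $W$ acts on $R_T^\wedge$. $\mathrm{Fun}(W,R_T^\wedge)$ is the ring of functions $W\to R_T^\wedge$. *)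

(* Defs.v *)
From HB Require Import structures.
From mathcomp Require Import all_boot all_order all_algebra.
Set Implicit Arguments. Unset Strict Implicit. Unset Printing Implicit Defensive.
Import Order.TTheory GRing.Theory Num.Theory.
Local Open Scope ring_scope.

(* Root datum of a semisimple group of ADJOINT type, given by its Cartan    *)
(* matrix A : 'M[int]_n with convention  A i j = <alpha_i^vee, alpha_j>.     *)
(* Adjoint type: X_*(T) = coweight lattice, with Z-basis the fundamental     *)
(* coweights varpi_1^vee..varpi_n^vee (dual to the simple roots).  Elements  *)
(* of X_*(T) are coordinate vectors 'I_n -> int in this basis.               *)

Definition is_finite_cartan (n : nat) (A : 'M[int]_n) : Prop :=
  [/\ forall i, A i i = 2,
      forall i j, i != j -> A i j <= 0,
      forall i j, (A i j == 0) = (A j i == 0)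
    & exists d : 'I_n -> rat,
        [/\ forall i, 0 < d i,
            forall i j, d i * (A i j)%:~R = d j * (A j i)%:~R
          & forall x : 'I_n -> rat, (exists i, x i != 0) ->
              0 < \sum_(i < n) \sum_(j < n) x i * d i * (A i j)%:~R * x j]].

Definition scoroot (n : nat) (A : 'M[int]_n) (i : 'I_n) : 'I_n -> int :=
  fun j => A i j.

(* simple reflection s_i on X_*(T):  lam |-> lam - <lam, alpha_i> alpha_i^vee,
   as an integer matrix acting on column coordinate vectors *)
Definition sref (n : nat) (A : 'M[int]_n) (i : 'I_n) : 'M[int]_n :=
  \matrix_(j, l) ((j == l)%:R - (i == l)%:R * A i j).

Definition in_W (n : nat) (A : 'M[int]_n) (w : 'M[int]_n) : Prop :=
  exists s : seq 'I_n, w = foldr (fun i acc => sref A i *m acc) 1%:M s.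

(* the coroot v(alpha_i^vee), for v in W (every coroot is of this form) *)
Definition coroot (n : nat) (A : 'M[int]_n) (v : 'M[int]_n) (i : 'I_n)
  : 'I_n -> int := fun j => \sum_(l < n) v j l * A i l.

(* R_T^ = completion of k[X_*(T)] at the augmentation ideal, realised as the *)
(* power series ring k[[x_1..x_n]] with x_i = e^{varpi_i^vee} - 1.           *)

Definition mi (n : nat) := {ffun 'I_n -> nat}.
Definition ps (k : fieldType) (n : nat) := mi n -> k.

Definition mdeg (n : nat) (m : mi n) : nat := (\sum_(i < n) m i)%N.

Definition ps_const (k : fieldType) (n : nat) (c : k) : ps k n :=
  fun m => if m == [ffun => 0%N] then c else 0.
Definition ps_add (k : fieldType) (n : nat) (f g : ps k n) : ps k n :=
  fun m => f m + g m.
Definition ps_sub (k : fieldType) (n : nat) (f g : ps k n) : ps k n :=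
  fun m => f m - g m.
Definition ps_mul (k : fieldType) (n : nat) (f g : ps k n) : ps k n :=
  fun m => \sum_(a : {ffun 'I_n -> 'I_(mdeg m).+1} | [forall i, (a i <= m i)%N])
             f [ffun i => nat_of_ord (a i)] * g [ffun i => (m i - a i)%N].
Definition ps_pow (k : fieldType) (n : nat) (f : ps k n) (e : nat) : ps k n :=
  iter e (ps_mul f) (@ps_const k n 1).

(* generalized binomial coefficient: coefficient of x^j in (1+x)^a, a : int *)
Definition gbinom (a : int) (j : nat) : int :=
  match a with
  | Posz a => ('C(a, j))%:Z
  | Negz a => (-1) ^+ j * ('C(a + j, j))%:Z   (* Negz a = -(a+1) *)
  end.

(* e^lam = prod_i (1 + x_i)^{lam_i} for lam in X_*(T) *)
Definition ps_exp (k : fieldType) (n : nat) (lam : 'I_n -> int) : ps k n :=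
  fun m => \prod_(i < n) (gbinom (lam i) (m i))%:~R.

(* w(x_i) = e^{w varpi_i^vee} - 1 *)
Definition wvar (k : fieldType) (n : nat) (w : 'M[int]_n) (i : 'I_n) : ps k n :=
  ps_sub (ps_exp k (fun j => w j i)) (@ps_const k n 1).

Definition wmono (k : fieldType) (n : nat) (w : 'M[int]_n) (m : mi n) : ps k n :=
  foldr (fun i acc => ps_mul (ps_pow (wvar k w i) (m i)) acc)
        (@ps_const k n 1) (enum 'I_n).

(* action of w in GL(X_*(T)) on R_T^ : continuous extension of e^lam |-> e^{w lam} *)
Definition ps_act (k : fieldType) (n : nat) (w : 'M[int]_n) (f : ps k n) : ps k n :=
  fun p => \sum_(m : {ffun 'I_n -> 'I_(mdeg p).+1} |
                   (\sum_(i < n) nat_of_ord (m i) <= mdeg p)%N)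
             f [ffun i => nat_of_ord (m i)] *
             wmono k w [ffun i => nat_of_ord (m i)] p.

Definition invariant (k : fieldType) (n : nat) (A : 'M[int]_n) (c : ps k n) : Prop :=
  forall w, in_W A w -> ps_act w c = c.

(* Tensor product over (R_T^)^W.  An element sum_l a_l (x) b_l is given by a *)
(* finite list of pairs; it is zero iff every (R_T^)^W-balanced biadditive   *)
(* map to an abelian group kills it (universal property of the tensor prod). *)

Definition balanced (k : fieldType) (n : nat) (A : 'M[int]_n) (V : zmodType)
  (beta : ps k n -> ps k n -> V) : Prop :=
  [/\ forall a a' b, beta (ps_add a a') b = beta a b + beta a' b,
      forall a b b', beta a (ps_add b b') = beta a b + beta a b'
    & forall a s b, invariant A s -> beta (ps_mul a s) b = beta a (ps_mul s b)].

Definition tensor_zero (k : fieldType) (n : nat) (A : 'M[int]_n)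
  (L : seq (ps k n * ps k n)) : Prop :=
  forall (V : zmodType) (beta : ps k n -> ps k n -> V),
    balanced A beta -> \sum_(ab <- L) beta ab.1 ab.2 = 0.

Definition tau (k : fieldType) (n : nat) (L : seq (ps k n * ps k n))
  (w : 'M[int]_n) : ps k n :=
  foldr (fun ab acc => ps_add (ps_mul ab.1 (ps_act (invmx w) ab.2)) acc)
        (@ps_const k n 0) L.

Definition ps_cong (k : fieldType) (n : nat) (f g h : ps k n) : Prop :=
  exists q, ps_sub f g = ps_mul h q.

(* Main.v *)
Require Import Defs.
From HB Require Import structures.
From mathcomp Require Import all_boot all_order all_algebra.
From mathcomp Require Import boolp zify ring lra.
Import Order.TTheory GRing.Theory Num.Theory.
Local Open Scope ring_scope.
Set Implicit Arguments. Unset Strict Implicit. Unset Printing Implicit Defensive.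

(* Let e^v be the exponentials in R = k[[x_1..x_n]] and D_i the Demazure operator
     (D_i f)(w) = (f(w) - e^{-alpha_i} s_i(f(w s_i))) / (1 - e^{-alpha_i})
   (alpha_i the simple coroots), acting on the functions that satisfy the congruences and, through the
   first factor, on R (x) R. The D_i are idempotents satisfying the braid relations, tau commutes with
   them, and D_i(e^v x) = e^v D_i(x) if <v, alpha_i> = 0, while D_i(e^v x) = e^{v - alpha_i} D_i(x) + e^v x
   if <v, alpha_i> = 1. Both halves of the theorem say that a subquotient Q (functions modulo the image;
   the kernel of tau) vanishes. If x is a nonzero element of the form D_w(y) with w of maximal length, then
   D_i x = x or D_i x = 0 for each i; multiplying x by e^v, v the sum of the fundamental coweights over the
   i with D_i x = 0 (this is where the adjoint type enters), gives a nonzero element of Q fixed by all D_i.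
   But an element fixed by all D_i is zero in Q, since a function fixed by all D_i is w |-> w^{-1}(f(1)). *)

(** * The ring of power series *)

(** No theory of the Weyl group is presupposed: no finiteness, length function, reduced words or
    exchange property. The numbers game on the orbit of (1,...,1) replaces them. A legal firing
    sequence stands for a reduced word, a state with only negative chips for the longest element;
    rank two polygons give the exchange property, and definiteness of the form gives termination.

    The two halves are instances of one vanishing statement with two relations: [eqv] is equality in
    Q, [sim] is equality on the nose. The final step needs an element fixed up to [sim]: a list of
    pairs fixed entry by entry has invariant first factors, which can cross the tensor sign, whereas
    a class fixed only as a tensor offers no such hold. Applying D_w for the longest w turns
    invariance up to [eqv] into invariance up to [sim].

    The field is arbitrary, so a coroot may be divisible by the characteristic in X_*(T), and 1 -
    e^v may be a proper power. Divisibility is therefore studied in lattice coordinates adapted to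
    v, where 1 - e^v is a power of a variable times a unit. *)

Lemma big_seq_pred1 (V : nmodType) (I : eqType) (r : seq I) (x : I) (F : I -> V) :
  uniq r -> x \in r -> \sum_(y <- r | y == x) F y = F x.
Proof.
move=> ur xr; rewrite big_mkcond (bigD1_seq x) //= eqxx big1 ?addr0 // => y.
by move/negbTE->.
Qed.

Section Exponents.
Variable n : nat.
Implicit Types (a b m : mi n) (D : nat).

Definition below D : seq (mi n) :=
  [seq ([ffun i => nat_of_ord (a i)] : mi n) | a : {ffun 'I_n -> 'I_D.+1}].

Lemma mem_below m D : (m \in below D) = [forall i, (m i <= D)%N].
Proof.
apply/imageP/forallP => [[a _ ->] i|h]; first by rewrite ffunE -ltnS ltn_ord.
exists [ffun i => inord (m i)] => //.
by apply/ffunP=> i; rewrite !ffunE inordK // ltnS.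
Qed.

Lemma below_uniq D : uniq (below D).
Proof.
rewrite map_inj_uniq ?enum_uniq // => a b /ffunP e.
by apply/ffunP=> i; apply/val_inj; have := e i; rewrite !ffunE.
Qed.

Lemma big_below (V : nmodType) (P : pred (mi n)) (F : mi n -> V) D E :
  (forall m, P m -> m \in below D) -> (forall m, P m -> m \in below E) ->
  \sum_(m <- below D | P m) F m = \sum_(m <- below E | P m) F m.
Proof.
move=> hD hE; rewrite -big_filter -[RHS]big_filter.
apply/perm_big/uniq_perm; rewrite ?filter_uniq ?below_uniq // => m.
by rewrite !mem_filter; case: (boolP (P m)) => //= h; rewrite hD ?hE.
Qed.

Lemma big_below0 (V : nmodType) (F : mi n -> V) D E :
  (forall m, F m != 0 -> m \in below D) -> (forall m, F m != 0 -> m \in below E) ->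
  \sum_(m <- below D) F m = \sum_(m <- below E) F m.
Proof.
move=> hD hE; have h D' : \sum_(m <- below D') F m = \sum_(m <- below D' | F m != 0) F m.
  by rewrite [RHS]big_mkcond; apply: eq_bigr => m _; case: eqP.
by rewrite !h; apply: big_below.
Qed.

Lemma mdeg_ge m i : (m i <= mdeg m)%N.
Proof. by rewrite /mdeg (bigD1 i) //= leq_addr. Qed.

Lemma below_mdeg m D : (mdeg m <= D)%N -> m \in below D.
Proof. by rewrite mem_below => h; apply/forallP=> i; apply: leq_trans (mdeg_ge m i) h. Qed.

Lemma addmE a b i : (a + b) i = (a i + b i)%N.
Proof. by rewrite ffunE. Qed.

Lemma zeromE i : (0 : mi n) i = 0%N.
Proof. by rewrite ffunE. Qed.

Lemma mdegD a b : mdeg (a + b) = (mdeg a + mdeg b)%N.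
Proof. by rewrite /mdeg -big_split; apply: eq_bigr => i _; rewrite addmE. Qed.

Lemma mdeg0 : mdeg (0 : mi n) = 0%N.
Proof. by rewrite /mdeg big1 // => i _; rewrite zeromE. Qed.

Lemma mdeg_eq0 m : (mdeg m == 0%N) = (m == 0).
Proof.
apply/idP/eqP => [h|->]; last by rewrite mdeg0.
apply/ffunP=> i; rewrite zeromE; apply/eqP; rewrite -leqn0 -(eqP h); exact: mdeg_ge.
Qed.

Lemma addm_inj a : injective (+%R a).
Proof. by move=> b c /ffunP h; apply/ffunP=> i; have := h i; rewrite !addmE; apply: addnI. Qed.

Lemma below_add a b D : a + b \in below D -> (a \in below D) /\ (b \in below D).
Proof.
rewrite !mem_below => /forallP h; split; apply/forallP=> i; apply: leq_trans (h i);
  by rewrite addmE ?leq_addl ?leq_addr.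
Qed.

End Exponents.

Section Ring.
Variables (k : fieldType) (n : nat).
Implicit Types (f g h : ps k n) (a b m p : mi n).

(** A form symmetric in the two factors, over a box of exponents as large as one likes:
    commutativity and associativity become exchanges of sums over one common box. *)
Lemma ps_mulE f g m D : m \in below n D ->
  ps_mul f g m = \sum_(a <- below n D) \sum_(b <- below n D | a + b == m) f a * g b.
Proof.
move=> mD; rewrite /ps_mul.
have inner a : \sum_(b <- below n D | a + b == m) f a * g b =
    if [forall i, (a i <= m i)%N] then f a * g [ffun i => (m i - a i)%N] else 0.
  case: ifP => [/forallP h|h].
    have e : a + [ffun i => (m i - a i)%N] = m.
      by apply/ffunP=> i; rewrite addmE ffunE subnKC.
    rewrite (eq_bigl (pred1 [ffun i => (m i - a i)%N])) => [|b]; last first.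
      by rewrite -{1}e (inj_eq (@addm_inj _ a)).
    by rewrite big_seq_pred1 ?below_uniq //; have [|//] := @below_add _ a [ffun i => (m i - a i)%N] D; rewrite ?e.
  rewrite big1 // => b /eqP e; case/negP: h; apply/forallP=> i.
  by rewrite -e addmE leq_addr.
under [RHS]eq_bigr => a _ do rewrite inner.
rewrite -[RHS]big_mkcond (big_below _ (E := mdeg m)) //=.
- rewrite big_image_cond; apply: eq_big => [a|a _].
    by apply: eq_forallb => i; rewrite ffunE.
  by congr (_ * g _); apply/ffunP=> i; rewrite !ffunE.
- move=> a /forallP h; rewrite mem_below; apply/forallP=> i; apply: leq_trans (h i) _.
  by move: mD; rewrite mem_below => /forallP.
- by move=> a /forallP h; rewrite mem_below; apply/forallP=> i; apply: leq_trans (h i) (mdeg_ge _ _).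
Qed.

Lemma ps_mulC f g : ps_mul f g = ps_mul g f.
Proof.
apply/funext=> m; have mD := below_mdeg (leqnn (mdeg m)).
rewrite !(ps_mulE _ _ mD) (exchange_big_dep predT) //=; apply: eq_bigr => a _.
apply: eq_big => [b|b _]; last exact: mulrC.
by congr (_ == _); apply: addrC.
Qed.

Lemma ps_mulE3 f g h m D : m \in below n D ->
  ps_mul h (ps_mul f g) m = \sum_(d <- below n D) \sum_(a <- below n D)
     \sum_(b <- below n D | d + (a + b) == m) h d * (f a * g b).
Proof.
move=> mD; rewrite (ps_mulE _ _ mD); apply: eq_bigr => d _.
transitivity (\sum_(c <- below n D | d + c == m) \sum_(a <- below n D)
     \sum_(b <- below n D | a + b == c) h d * (f a * g b)).
  rewrite big_seq_cond [RHS]big_seq_cond; apply: eq_bigr => c /andP[cD _].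
  rewrite (ps_mulE _ _ cD) mulr_sumr; apply: eq_bigr => a _.
  by rewrite mulr_sumr.
rewrite (exchange_big_dep predT) //=; apply: eq_bigr => a _.
rewrite (exchange_big_dep predT) //= [RHS]big_mkcond; apply: eq_bigr => b _.
case: ifP => [/eqP e|e].
  rewrite (eq_bigl (pred1 (a + b))) => [|c].
    rewrite big_seq_pred1 ?below_uniq //.
    by case: (@below_add _ d (a + b) D); rewrite ?e.
  by rewrite [a + b == c]eq_sym /=; case: (c =P a + b) => [->|_]; rewrite ?e ?eqxx ?andbF.
rewrite big_pred0 // => c; apply: contraFF e => /andP[dc ab].
by rewrite (eqP ab); case/andP: dc.
Qed.

Lemma ps_mulA f g h : ps_mul f (ps_mul g h) = ps_mul (ps_mul f g) h.
Proof.
apply/funext=> m; have mD := below_mdeg (leqnn (mdeg m)).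
rewrite [ps_mul (ps_mul f g) h]ps_mulC !(ps_mulE3 _ _ _ mD) [RHS]exchange_big /=.
apply: eq_bigr => a _; rewrite [RHS](exchange_big_dep predT) //=.
apply: eq_bigr => b _; apply: eq_big => [d|d _]; last by rewrite mulrA mulrC.
by congr (_ == _); rewrite addrA; apply: addrC.
Qed.

Lemma ps_mul1 f : ps_mul (@ps_const k n 1) f = f.
Proof.
apply/funext=> m; have mD := below_mdeg (leqnn (mdeg m)).
rewrite (ps_mulE _ _ mD) (bigD1_seq 0) ?below_uniq //=; last first.
  by apply: below_mdeg; rewrite mdeg0.
rewrite [X in _ + X]big1 ?addr0 => [|a a0]; last first.
  rewrite big1 // => b _; rewrite /ps_const; case: eqP => [e|]; last by rewrite mul0r.
  by rewrite e in a0; case/eqP: a0; apply/ffunP=> i; rewrite !ffunE.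
rewrite (eq_bigl (pred1 m)) => [|b]; last by rewrite add0r.
by rewrite big_seq_pred1 ?below_uniq // /ps_const ifT ?mul1r.
Qed.

Lemma ps_mulDl : left_distributive (@ps_mul k n) (@ps_add k n).
Proof.
move=> f g h; apply/funext=> m; have mD := below_mdeg (leqnn (mdeg m)).
rewrite /ps_add !(ps_mulE _ _ mD) -big_split; apply: eq_bigr => a _.
by rewrite -big_split; apply: eq_bigr => b _; rewrite mulrDl.
Qed.

HB.instance Definition _ := gen_eqMixin (ps k n).
HB.instance Definition _ := gen_choiceMixin (ps k n).

Fact ps_addA : associative (@ps_add k n).
Proof. by move=> f g h; apply/funext=> m; apply: addrA. Qed.
Fact ps_addC : commutative (@ps_add k n).
Proof. by move=> f g; apply/funext=> m; apply: addrC. Qed.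
Fact ps_add0 : left_id (@ps_const k n 0) (@ps_add k n).
Proof. by move=> f; apply/funext=> m; rewrite /ps_add /ps_const if_same add0r. Qed.
Fact ps_addN : left_inverse (@ps_const k n 0) (fun f : ps k n => ((fun m => - f m) : ps k n)) (@ps_add k n).
Proof. by move=> f; apply/funext=> m; rewrite /ps_add /ps_const if_same addNr. Qed.

HB.instance Definition _ := GRing.isZmodule.Build (ps k n) ps_addA ps_addC ps_add0 ps_addN.

Fact ps_1_neq0 : @ps_const k n 1 != 0 :> ps k n.
Proof.
apply/eqP => /(congr1 (fun f => f [ffun => 0%N])) /eqP.
by rewrite /GRing.zero /= /ps_const eqxx oner_eq0.
Qed.

HB.instance Definition _ := GRing.Zmodule_isComNzRing.Build (ps k n)
  ps_mulA ps_mulC ps_mul1 ps_mulDl ps_1_neq0.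
End Ring.

(** * Monomials, order of vanishing and infinite sums *)

Section Coef.
Variables (k : fieldType) (n : nat).
Implicit Types (f g h : ps k n) (a b m p : mi n) (c : k).
Local Notation C := (@ps_const k n).

Lemma psDE f g m : (f + g) m = f m + g m. Proof. by []. Qed.
Lemma psBE f g m : (f - g) m = f m - g m. Proof. by []. Qed.
Lemma ps0E m : (0 : ps k n) m = 0. Proof. by rewrite /GRing.zero /= /ps_const if_same. Qed.
Lemma ps1E : C 1 = 1. Proof. by []. Qed.

Lemma ps_sumE (I : Type) (r : seq I) (P : pred I) (F : I -> ps k n) m :
  (\sum_(i <- r | P i) F i) m = \sum_(i <- r | P i) F i m.
Proof. by apply: (big_morph (fun f : ps k n => f m)) => //; exact: ps0E. Qed.

Lemma psME f g m D : m \in below n D ->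
  (f * g) m = \sum_(a <- below n D) \sum_(b <- below n D | a + b == m) f a * g b.
Proof. exact: ps_mulE. Qed.

Lemma constE c m : C c m = if m == 0 then c else 0.
Proof.
rewrite /ps_const; have -> : [ffun=> 0%N] = 0 :> mi n by apply/ffunP=> i; rewrite !ffunE.
by [].
Qed.

Definition mon a : ps k n := fun m => (m == a)%:R.

Lemma mon0 : mon 0 = 1.
Proof. by apply/funext => m; rewrite -ps1E constE /mon; case: eqP. Qed.

Lemma mon_mulE a f m : (mon a * f) (a + m) = f m.
Proof.
have mD := below_mdeg (leqnn (mdeg (a + m))); have [aD bD] := below_add mD.
rewrite (psME _ _ mD) (bigD1_seq a) ?below_uniq //= [X in _ + X]big1 ?addr0 => [|b ba]; last first.
  by rewrite big1 // => d _; rewrite /mon (negbTE ba) mul0r.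
rewrite (eq_bigl (pred1 m)) => [|b]; last by rewrite (inj_eq (@addm_inj _ a)).
by rewrite big_seq_pred1 ?below_uniq // /mon eqxx mul1r.
Qed.

Lemma mon_mulE0 a f p : (forall m, a + m != p) -> (mon a * f) p = 0.
Proof.
move=> h; rewrite (psME _ _ (below_mdeg (leqnn (mdeg p)))) big1 // => b _.
by rewrite big1 // => d /eqP e; rewrite /mon; case: eqP => [e1|]; rewrite ?mul0r //;
  have := h d; rewrite -e1 e eqxx.
Qed.

Lemma mi_subP a p : (exists m, a + m = p) \/ (forall m, a + m != p).
Proof.
case: (boolP [forall i, (a i <= p i)%N]) => [/forallP h|h].
  by left; exists [ffun i => (p i - a i)%N]; apply/ffunP=> i; rewrite addmE ffunE subnKC.
right=> m; apply: contraNneq h => <-; apply/forallP=> i; by rewrite addmE leq_addr.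
Qed.

Lemma mon_mul_inj a : injective ( *%R (mon a)).
Proof. by move=> f g h; apply/funext=> m; rewrite -(mon_mulE a f) h mon_mulE. Qed.

Lemma monD a b : mon (a + b) = mon a * mon b.
Proof.
apply/funext=> p; case: (mi_subP a p) => [[m <-]|h].
  by rewrite mon_mulE /mon (inj_eq (@addm_inj _ a)).
rewrite mon_mulE0 // /mon; case: eqP => // e; by have := h b; rewrite e eqxx.
Qed.

Lemma monX a e : mon (a *+ e) = mon a ^+ e.
Proof. by elim: e => [|e IH]; rewrite ?mon0 // mulrS monD IH exprS. Qed.

Lemma mon_dvdP a f : (forall m, (forall d, a + d != m) -> f m = 0) -> exists g, f = mon a * g.
Proof.
move=> h; exists (fun m => f (a + m)); apply/funext=> p.
by case: (mi_subP a p) => [[m <-]|hp]; [rewrite mon_mulE | rewrite mon_mulE0 ?h].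
Qed.

Lemma constM_coef c f m : (C c * f) m = c * f m.
Proof.
have mD := below_mdeg (leqnn (mdeg m)).
rewrite (psME _ _ mD) (bigD1_seq 0) ?below_uniq //=; last by apply: below_mdeg; rewrite mdeg0.
rewrite [X in _ + X]big1 ?addr0 => [|b b0]; last first.
  by rewrite big1 // => d _; rewrite constE (negbTE b0) mul0r.
rewrite (eq_bigl (pred1 m)) => [|b]; last by rewrite add0r.
by rewrite big_seq_pred1 ?below_uniq // constE eqxx.
Qed.

Lemma constM c d : C (c * d) = C c * C d.
Proof. by apply/funext=> m; rewrite constM_coef !constE; case: eqP; rewrite ?mulr0. Qed.

Lemma constD c d : C (c + d) = C c + C d.
Proof. by apply/funext=> m; rewrite psDE !constE; case: eqP; rewrite ?addr0. Qed.

Lemma const0 : C 0 = 0. Proof. by []. Qed.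

Lemma const_sum (I : Type) (r : seq I) (P : pred I) (F : I -> k) :
  C (\sum_(i <- r | P i) F i) = \sum_(i <- r | P i) C (F i).
Proof. by apply: (big_morph C constD). Qed.

Lemma mul_local f f' g g' p :
  (forall q, (mdeg q <= mdeg p)%N -> f q = f' q) ->
  (forall q, (mdeg q <= mdeg p)%N -> g q = g' q) -> (f * g) p = (f' * g') p.
Proof.
move=> hf hg; rewrite !(psME _ _ (below_mdeg (leqnn (mdeg p)))).
apply: eq_bigr => a _; apply: eq_bigr => b /eqP e.
by rewrite hf ?hg // -e mdegD ?leq_addl ?leq_addr.
Qed.

Definition ord_ge d f := forall m, (mdeg m < d)%N -> f m = 0.

Lemma ord_geM d e f g : ord_ge d f -> ord_ge e g -> ord_ge (d + e) (f * g).
Proof.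
move=> hf hg m md; rewrite (psME _ _ (below_mdeg (leqnn (mdeg m)))) big1 // => a _.
rewrite big1 // => b /eqP ab; case: (ltnP (mdeg a) d) => h; first by rewrite hf ?mul0r.
rewrite hg ?mulr0 // -(ltn_add2l d); apply: leq_ltn_trans md.
by rewrite -ab mdegD leq_add2r.
Qed.

Lemma ord_geX d f e : ord_ge d f -> ord_ge (d * e) (f ^+ e).
Proof.
move=> h; elim: e => [|e IH]; first by rewrite muln0.
by rewrite mulnS exprS; apply: ord_geM.
Qed.

(** The shift [c] is the number of degrees that a term may lose: 0 for a substitution, 1 for the
    quotient in [act_dvd], whose term at [m] may start in degree [mdeg m - 1]. *)
Definition summable (c : nat) (F : mi n -> ps k n) :=
  forall m p, (mdeg p + c < mdeg m)%N -> F m p = 0.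

Definition psum (c : nat) (F : mi n -> ps k n) : ps k n :=
  fun p => \sum_(m <- below n (mdeg p + c)) F m p.

Lemma psumE (c : nat) F p D : summable c F -> (mdeg p + c <= D)%N ->
  psum c F p = (\sum_(m <- below n D) F m) p.
Proof.
move=> sF hD; rewrite ps_sumE; apply: big_below0 => m; apply: contraNT => h; apply/eqP/sF.
  by rewrite ltnNge; apply: contra h; apply: below_mdeg.
by rewrite ltnNge; apply: contra h => h; apply: below_mdeg; apply: leq_trans hD.
Qed.

Lemma mul_psum (c : nat) F g : summable c F -> g * psum c F = psum c (fun m => g * F m).
Proof.
move=> sF; apply/funext=> p.
rewrite (mul_local (g' := \sum_(m <- below n (mdeg p + c)) F m) (f' := g)) => //.
  by rewrite mulr_sumr ps_sumE.
by move=> q hq; apply: psumE => //; rewrite leq_add2r.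
Qed.

End Coef.

(** * Substitution of series without constant term *)

Section Subst.
Variables (k : fieldType) (n : nat) (y : 'I_n -> ps k n).
Hypothesis y1 : forall i, ord_ge 1 (y i).
Implicit Types (f g h : ps k n) (a b m p : mi n) (c : k).
Local Notation C := (@ps_const k n).

Definition ymon m := \prod_i y i ^+ m i.
Definition subst f := psum 0 (fun m => C (f m) * ymon m).

Lemma ymonD a b : ymon (a + b) = ymon a * ymon b.
Proof. by rewrite /ymon -big_split; apply: eq_bigr => i _; rewrite addmE exprD. Qed.

Lemma ord_ymon m : ord_ge (mdeg m) (ymon m).
Proof.
rewrite /mdeg /ymon; apply: (big_ind2 (fun d f => ord_ge d f)) => //.
  by move=> d f e g; apply: ord_geM.
by move=> i _; have := ord_geX (e := m i) (y1 i); rewrite mul1n.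
Qed.

Lemma summable_subst f : summable 0 (fun m => C (f m) * ymon m).
Proof. by move=> m p; rewrite addn0 => h; rewrite constM_coef ord_ymon ?mulr0. Qed.

Lemma substE f p D : (mdeg p <= D)%N ->
  subst f p = (\sum_(m <- below n D) C (f m) * ymon m) p.
Proof. by move=> h; apply: psumE; rewrite ?addn0 //; apply: summable_subst. Qed.

Lemma substB : zmod_morphism subst.
Proof.
move=> f g; apply/funext=> p; rewrite psBE !(substE _ (leqnn _)) !ps_sumE -sumrB.
by apply: eq_bigr => m _; rewrite !constM_coef -mulrBl.
Qed.

Lemma subst1 : subst 1 = 1.
Proof.
apply/funext=> p; rewrite (substE _ (leqnn _)) (bigD1_seq 0) ?below_uniq //=; last first.
  by apply: below_mdeg; rewrite mdeg0.
rewrite big1 ?addr0 => [|m m0]; last by rewrite -ps1E constE (negbTE m0) const0 mul0r.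
by rewrite -ps1E constE eqxx mul1r /ymon big1 // => i _; rewrite zeromE.
Qed.

Lemma substM f g : subst (f * g) = subst f * subst g.
Proof.
apply/funext=> p; set B := below n (mdeg p).
have loc h q : (mdeg q <= mdeg p)%N -> subst h q = (\sum_(m <- B) C (h m) * ymon m) q.
  by move=> ?; apply: substE.
rewrite [RHS](mul_local (loc f) (loc g)) loc //.
rewrite mulr_suml ps_sumE.
under eq_big_seq => m mB do rewrite (psME _ _ mB) const_sum mulr_suml.
rewrite (eq_bigr (fun m => \sum_(a <- B) \sum_(b <- B | a + b == m) (C (f a * g b) * ymon m) p)) => [|m _]; last first.
  rewrite ps_sumE; apply: eq_bigr => a _; rewrite const_sum mulr_suml ps_sumE; exact: eq_bigr.
rewrite exchange_big /= ps_sumE; apply: eq_bigr => a _.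
rewrite mulr_sumr ps_sumE (exchange_big_dep predT) //=; apply: eq_bigr => b _.
rewrite constM mulrACA -ymonD.
have [ab|ab] := boolP (a + b \in B).
  rewrite (eq_bigl (pred1 (a + b))) => [|c]; last by rewrite eq_sym.
  by rewrite big_seq_pred1 ?below_uniq // -constM.
(* The remaining pairs have [a + b] outside the box, hence of degree above [mdeg p]: their terms
   vanish at [p] on the right and are absent on the left. *)
rewrite -constM constM_coef ord_ymon ?mulr0; last first.
  by rewrite ltnNge; apply: contra ab; apply: below_mdeg.
rewrite big_seq_cond big_pred0 // => m; apply/negP => /andP[mB /eqP e].
by rewrite e mB in ab.
Qed.

Lemma subst_const c : subst (C c) = C c.
Proof.
apply/funext=> p; rewrite (substE _ (leqnn _)) (bigD1_seq 0) ?below_uniq //=; last first.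
  by apply: below_mdeg; rewrite mdeg0.
rewrite big1 ?addr0 => [|m m0]; last by rewrite constE (negbTE m0) const0 mul0r.
by rewrite constE eqxx /ymon big1 ?mulr1 // => i _; rewrite zeromE.
Qed.

Lemma ord_subst d f : ord_ge d f -> ord_ge d (subst f).
Proof.
move=> hf p hp; rewrite (substE _ (leqnn _)) ps_sumE big1 // => m _.
rewrite constM_coef; case: (ltnP (mdeg m) d) => h; first by rewrite hf ?mul0r.
by rewrite ord_ymon ?mulr0 //; apply: leq_trans h.
Qed.

End Subst.

Section Unique.
Variables (k : fieldType) (n : nat).
Implicit Types (f g h : ps k n) (a b m p : mi n) (c : k).
Local Notation C := (@ps_const k n).

Definition ei (i : 'I_n) : mi n := [ffun j => (j == i) : nat].
Definition Xi i : ps k n := mon k (ei i).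

Lemma mdeg_ei i : mdeg (ei i) = 1%N.
Proof.
rewrite /mdeg (bigD1 i) //= big1 ?addn0 => [|j ji]; rewrite ffunE ?eqxx //.
by rewrite (negbTE ji).
Qed.

Lemma mi_sum m : m = \sum_i ei i *+ m i.
Proof.
apply/ffunP=> j; rewrite (big_morph (fun m : mi n => m j) (fun a b => addmE a b j) (zeromE j)).
rewrite (bigD1 j) //= big1 ?addn0 => [|i ij].
  by elim: (m j) => [|e IH]; rewrite ?zeromE // mulrS addmE -IH ffunE eqxx.
by elim: (m i) => [|e IH]; rewrite ?zeromE // mulrS addmE IH ffunE eq_sym (negbTE ij).
Qed.

Lemma mon_prod m : mon k m = \prod_i Xi i ^+ m i.
Proof.
rewrite {1}(mi_sum m) (big_morph (@mon k n) (@monD k n) (mon0 k n)).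
by apply: eq_bigr => i _; rewrite monX.
Qed.

Lemma ord_Xi i : ord_ge 1 (Xi i).
Proof.
move=> m; rewrite ltnS leqn0 mdeg_eq0 => /eqP->; rewrite /Xi /mon.
by case: eqP => // /(congr1 (@mdeg n)); rewrite mdeg0 mdeg_ei.
Qed.

Lemma mon_sum_local f p D : (mdeg p <= D)%N ->
  f p = (\sum_(m <- below n D) C (f m) * mon k m) p.
Proof.
move=> h; rewrite ps_sumE (bigD1_seq p) ?below_uniq ?below_mdeg //= constM_coef /mon eqxx mulr1.
by rewrite big1 ?addr0 // => m mp; rewrite constM_coef eq_sym (negbTE mp) mulr0.
Qed.

(** Preservation of [ord_ge] stands for continuity: up to degree [mdeg p] the series [f] is a
    polynomial, whose image is known from the variables. This reduces [act_mul] to a check on the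
    variables. *)
Lemma subst_uniq (phi : {rmorphism ps k n -> ps k n}) f :
  (forall c, phi (C c) = C c) -> (forall d g, ord_ge d g -> ord_ge d (phi g)) ->
  phi f = subst (fun i => phi (Xi i)) f.
Proof.
move=> phiC phio; have y1 i : ord_ge 1 (phi (Xi i)) by apply/phio/ord_Xi.
apply/funext=> p; rewrite (substE y1 _ (leqnn _)).
set S := \sum_(m <- below n (mdeg p)) C (f m) * mon k m.
have hS : ord_ge (mdeg p).+1 (f - S).
  by move=> m; rewrite ltnS => hm; rewrite psBE /S -(mon_sum_local f hm) subrr.
have /eqP := phio _ _ hS p (ltnSn _); rewrite rmorphB psBE subr_eq0 => /eqP ->.
rewrite /S rmorph_sum !ps_sumE; apply: eq_bigr => m _.
rewrite rmorphM /= phiC mon_prod rmorph_prod.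
by under eq_bigr do rewrite rmorphXn.
Qed.

Lemma subst_id f : subst Xi f = f.
Proof.
apply/funext=> p; rewrite (substE ord_Xi _ (leqnn _)) [RHS](mon_sum_local _ (leqnn _)).
by rewrite !ps_sumE; apply: eq_bigr => m _; rewrite mon_prod.
Qed.

Lemma subst_Xi y i : (forall i, ord_ge 1 (y i)) -> subst y (Xi i) = y i.
Proof.
move=> y1; apply/funext=> p; have D1 : (mdeg p <= (mdeg p).+1)%N by [].
rewrite (substE y1 _ D1) (bigD1_seq (ei i)) ?below_uniq //=; last by apply: below_mdeg; rewrite mdeg_ei.
rewrite big1 ?addr0 => [|m mi]; last by rewrite /Xi /mon (negbTE mi) const0 mul0r.
rewrite /Xi /mon eqxx ps1E mul1r /ymon (bigD1 i) //= ffunE eqxx expr1 big1 ?mulr1 // => j ji.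
by rewrite ffunE (negbTE ji).
Qed.

End Unique.

(** * Exponentials and the action of integer matrices *)

Lemma gbinom0 a : gbinom a 0 = 1.
Proof. by case: a => a /=; rewrite ?bin0 ?addn0 ?expr0 ?mul1r ?bin0. Qed.

Lemma gbinom0l j : gbinom 0 j.+1 = 0.
Proof. by []. Qed.

Lemma gbinom_Pascal a j : gbinom (a + 1) j.+1 = gbinom a j.+1 + gbinom a j.
Proof.
case: a => [a|[|a]].
- by rewrite -PoszD addn1 /= binS PoszD.
- by rewrite /= !add0n !binn exprS; case: (j) => [|i]; rewrite ?bin0 ?expr0 //= !mulr1 mulN1r addNr.
rewrite (_ : Negz a.+1 + 1 = Negz a); last by rewrite /GRing.add /= subn1.
rewrite /= [(a.+1 + j.+1)%N]addSn binS PoszD mulrDr addSnnS -addrA exprS mulN1r !mulNr.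
by rewrite addNr addr0.
Qed.

Section Exp.
Variables (k : fieldType) (n : nat).
Implicit Types (f g : ps k n) (u v : 'cV[int]_n) (w : 'M[int]_n) (m p : mi n) (c : k).
Local Notation C := (@ps_const k n).

Definition ps_e v : ps k n := ps_exp k (fun j => v j 0).
Local Notation E := ps_e.
Definition varpi i : 'cV[int]_n := delta_mx i 0.

Lemma cV_ind (P : 'cV[int]_n -> Prop) :
  P 0 -> (forall v i, P v -> P (v + varpi i)) -> (forall v i, P v -> P (v - varpi i)) ->
  forall v, P v.
Proof.
move=> P0 PD PB v.
have step u i (z : int) : P u -> P (u + varpi i *~ z).
  move=> Pu; elim/int_ind: z => [|z IH|z IH]; first by rewrite mulr0z addr0.
    by rewrite intS [1 + _]addrC mulrzDr addrA; apply: PD.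
  by rewrite intS opprD [- 1 + _]addrC mulrzDr addrA (mulrNz _ 1); apply: PB.
have -> : v = \sum_(i <- enum 'I_n) varpi i *~ v i 0.
  rewrite big_enum /=; apply/colP=> i; rewrite summxE (bigD1 i) //= big1 ?addr0 => [|j ji].
    by rewrite -scaler_int !mxE !eqxx mulr1 intz.
  by rewrite -scaler_int !mxE eq_sym (negbTE ji) mulr0.
elim: (enum _) => [|i s IH]; first by rewrite big_nil.
by rewrite big_cons addrC; apply: step.
Qed.

Lemma ps_e0 : E 0 = 1.
Proof.
apply/funext=> m; rewrite -ps1E constE /ps_e /ps_exp.
case: eqP => [->|m0].
  by rewrite big1 // => i _; rewrite zeromE mxE gbinom0.
have [i mi] : exists i, m i != 0%N.
  apply/existsP; apply: contra_notT m0; rewrite negb_exists => /forallP h.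
  by apply/ffunP=> i; rewrite zeromE; apply/eqP/negbNE.
by rewrite (bigD1 i) //= mxE; move: mi; case: (m i) => // a _; rewrite gbinom0l mul0r.
Qed.

Lemma ps_e_at0 v : E v 0 = 1.
Proof. by rewrite /ps_e /ps_exp big1 // => i _; rewrite zeromE gbinom0. Qed.

Lemma ps_e_varpi v i : E (v + varpi i) = (1 + Xi k i) * E v.
Proof.
apply/funext=> m; rewrite mulrDl mul1r psDE.
have vi j : (v + varpi i) j 0 = v j 0 + (j == i)%:Z by rewrite !mxE eqxx andbT; case: eqP.
rewrite /ps_e /ps_exp (bigD1 i) //= [in RHS](bigD1 i) //= vi eqxx.
rewrite (eq_bigr (fun j => (gbinom (v j 0) (m j))%:~R)) => [|j ji]; last by rewrite vi (negbTE ji) addr0.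
have [[d md]|h] := mi_subP (ei i) m.
  rewrite -md mon_mulE [in X in _ = _ + X](bigD1 i) // addmE ffunE eqxx add1n gbinom_Pascal rmorphD mulrDl; congr (_ + _ * _).
  by apply: eq_bigr => j ji; rewrite addmE ffunE (negbTE ji).
rewrite mon_mulE0 // addr0; have -> : m i = 0%N; last by rewrite !gbinom0.
apply/eqP; apply: contraT => mi; have /eqP[] := h [ffun j => (m j - (j == i))%N].
apply/ffunP=> j; rewrite addmE !ffunE; case: eqP => [->|]; first by rewrite subnKC // lt0n.
by rewrite subn0.
Qed.

Lemma ps_e_varpi0 i : E (varpi i) = 1 + Xi k i.
Proof. by rewrite -[varpi i]add0r ps_e_varpi ps_e0 mulr1. Qed.

Lemma ps_e_varpiN i : (1 + Xi k i) * E (- varpi i) = 1.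
Proof. by rewrite -ps_e_varpi addNr ps_e0. Qed.

Lemma varpi_cancel i f g : (1 + Xi k i) * f = (1 + Xi k i) * g -> f = g.
Proof.
move=> h; have := congr1 ( *%R (E (- varpi i))) h.
by rewrite !mulrA [E _ * _]mulrC ps_e_varpiN !mul1r.
Qed.

(** Vandermonde's identity for integer exponents, reached by moving one fundamental coweight at a
    time: Pascal's rule, valid for negative entries too, makes each move a multiplication by
    [1 + Xi k i], which is invertible and can be cancelled. *)
Lemma ps_eD u v : E (u + v) = E u * E v.
Proof.
elim/cV_ind: v u => [u|v i IH u|v i IH u]; first by rewrite addr0 ps_e0 mulr1.
  by rewrite addrA !ps_e_varpi IH mulrCA.
by apply: (varpi_cancel (i := i)); rewrite -ps_e_varpi mulrCA -ps_e_varpi addrA !subrK IH.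
Qed.

Lemma ps_eNr v : E v * E (- v) = 1.
Proof. by rewrite -ps_eD subrr ps_e0. Qed.

Lemma ps_eNl v : E (- v) * E v = 1.
Proof. by rewrite mulrC ps_eNr. Qed.

Lemma wvarE w i : wvar k w i = E (w *m varpi i) - 1.
Proof.
congr (_ - _); rewrite /ps_e; congr ps_exp; apply/funext=> j.
by rewrite -colE mxE.
Qed.

Lemma ord_ps_e v : ord_ge 1 (E v - 1).
Proof.
move=> m; rewrite ltnS leqn0 mdeg_eq0 => /eqP ->.
by rewrite psBE ps_e_at0 -ps1E constE eqxx subrr.
Qed.

Lemma ord_wvar w i : ord_ge 1 (wvar k w i).
Proof. by rewrite wvarE; apply: ord_ps_e. Qed.

Lemma ps_powE f e : ps_pow f e = f ^+ e.
Proof. by elim: e => [|e IH] //; rewrite exprS -IH. Qed.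

Lemma wmonoE w m : wmono k w m = ymon (wvar k w) m.
Proof.
rewrite /ymon -big_enum /=; rewrite /wmono; elim: (enum _) => [|i s IH] /=; first by rewrite big_nil.
by rewrite big_cons IH ps_powE.
Qed.

(** The degree cutoff in [ps_act] loses nothing, since the image of the monomial [m] has no terms
    below degree [mdeg m]. *)
Lemma ps_actE w f : ps_act w f = subst (wvar k w) f.
Proof.
apply/funext=> p; rewrite /subst /psum addn0 /below big_image /= /ps_act.
rewrite big_mkcond; apply: eq_bigr => a _.
rewrite constM_coef wmonoE; case: ifP => // h.
rewrite (ord_ymon (@ord_wvar w)) ?mulr0 // /mdeg.
rewrite ltnNge; apply/negP => hle; move/negbT/negP: h; apply; apply: leq_trans hle.
by apply: eq_leq; apply: eq_bigr => i _; rewrite ffunE.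
Qed.

Fact ps_act_zmod w : zmod_morphism (@ps_act k n w).
Proof. by move=> f g; rewrite !ps_actE (substB (@ord_wvar w)). Qed.

Fact ps_act_monoid w : monoid_morphism (@ps_act k n w).
Proof.
split=> [|f g]; first by rewrite ps_actE (subst1 (@ord_wvar w)).
by rewrite !ps_actE (substM (@ord_wvar w)).
Qed.

HB.instance Definition _ w := GRing.isZmodMorphism.Build (ps k n) (ps k n) (@ps_act k n w) (@ps_act_zmod w).
HB.instance Definition _ w := GRing.isMonoidMorphism.Build (ps k n) (ps k n) (@ps_act k n w) (@ps_act_monoid w).

Lemma act_const w c : ps_act w (C c) = C c.
Proof. by rewrite ps_actE (subst_const (@ord_wvar w)). Qed.

Lemma act_ord w d f : ord_ge d f -> ord_ge d (ps_act w f).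
Proof. by rewrite ps_actE; apply: (ord_subst (@ord_wvar w)). Qed.

Lemma act_Xi w i : ps_act w (Xi k i) = E (w *m varpi i) - 1.
Proof. by rewrite ps_actE (subst_Xi _ (@ord_wvar w)) wvarE. Qed.

Lemma act_ps_e w v : ps_act w (E v) = E (w *m v).
Proof.
have act_varpi i : ps_act w (1 + Xi k i) = E (w *m varpi i).
  by rewrite rmorphD /= act_Xi rmorph1 addrC subrK.
elim/cV_ind: v => [|v i IH|v i IH]; first by rewrite mulmx0 ps_e0 rmorph1.
  by rewrite ps_e_varpi rmorphM /= IH act_varpi mulmxDr ps_eD mulrC.
have h := IH.
rewrite -[v](subrK (varpi i)) ps_e_varpi rmorphM /= act_varpi mulmxDr [in RHS]ps_eD mulrC in h.
have := congr1 ( *%R^~ (E (- (w *m varpi i)))) h.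
by rewrite /= -!mulrA ps_eNr !mulr1.
Qed.

Lemma act_mul w1 w2 f : ps_act w1 (ps_act w2 f) = ps_act (w1 *m w2) f.
Proof.
pose phi : {rmorphism ps k n -> ps k n} := (@ps_act k n w1 \o @ps_act k n w2).
rewrite -[LHS]/(phi f) (subst_uniq (phi := phi)) => [|c|d g dg].
- rewrite ps_actE; congr subst; apply/funext=> i; rewrite wvarE /phi /= act_Xi rmorphB rmorph1 /= act_ps_e.
  by rewrite mulmxA.
- by rewrite /phi /= !act_const.
- by rewrite /phi /=; do 2!apply: act_ord.
Qed.

Lemma act_1 f : ps_act 1%:M f = f.
Proof.
rewrite ps_actE -[RHS]subst_id; congr subst; apply/funext=> i.
by rewrite wvarE mul1mx ps_e_varpi0 addrC addKr.
Qed.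

End Exp.

(** * Divisibility by 1 - e^v *)

Section Divisibility.
Variables (k : fieldType) (n : nat).
Implicit Types (f g h q : ps k n) (u v : 'cV[int]_n) (w : 'M[int]_n) (m p : mi n) (i : 'I_n).
Local Notation C := (@ps_const k n).
Local Notation E := (@ps_e k n).
Local Notation X := (@Xi k n).

Lemma ps_inv f : f 0 != 0 -> exists g, f * g = 1.
Proof.
move=> f0; pose y : ps k n := 1 - C (f 0)^-1 * f.
have y1 : ord_ge 1 y.
  move=> m; rewrite ltnS leqn0 mdeg_eq0 => /eqP ->.
  by rewrite /y psBE constM_coef mulVf // -ps1E constE eqxx subrr.
(* The geometric series in [y], cut off separately for each coefficient. *)
pose g : ps k n := fun p => (\sum_(j < (mdeg p).+1) y ^+ j) p.
have gE p (q : mi n) : (mdeg q <= mdeg p)%N -> g q = (\sum_(j < (mdeg p).+1) y ^+ j) q.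
  move=> hq; rewrite /g -(subnKC hq) -addSn big_split_ord /= psDE [X in _ + X]ps_sumE [X in _ + X]big1 ?addr0 // => j _.
  have := ord_geX (e := (mdeg q).+1 + j) y1; rewrite mul1n; apply.
  by rewrite addSn ltnS leq_addr.
have yg : (1 - y) * g = 1.
  apply/funext=> p; rewrite (mul_local (f' := 1 - y) (fun _ _ => erefl) (gE p)).
  rewrite -opprB mulNr -subrX1 opprB psBE.
  have := ord_geX (e := (mdeg p).+1) y1; rewrite mul1n => -> //; by rewrite subr0.
exists (C (f 0)^-1 * g); rewrite mulrCA mulrA -[RHS]yg; congr (_ * g).
by rewrite /y opprB addrC subrK.
Qed.

Lemma Xi_reg i f : X i * f = 0 -> f = 0.
Proof. by move=> h; apply: (@mon_mul_inj _ _ (ei i)); rewrite [LHS]h mulr0. Qed.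

Lemma XiX_reg i r f : X i ^+ r * f = 0 -> f = 0.
Proof. by elim: r => [|r IH]; rewrite ?mul1r // exprS -mulrA => /Xi_reg. Qed.

Lemma ps_e_axis i (d : int) m : E (d *: varpi i) m =
  if m == ei i *+ m i then (gbinom d (m i))%:~R else 0.
Proof.
have dE j : (d *: varpi i) j 0 = if j == i then d else 0.
  by rewrite !mxE eqxx andbT; case: eqP; rewrite ?mulr1 ?mulr0.
have eE j e : (ei i *+ e) j = if j == i then e else 0%N.
  elim: e => [|e IH]; first by rewrite zeromE if_same.
  by rewrite mulrS addmE IH ffunE; case: eqP.
rewrite /ps_e /ps_exp (bigD1 i) // dE eqxx; case: eqP => [e|e].
  rewrite big1 /= ?mulr1 // => j ji; rewrite dE (negbTE ji) e eE (negbTE ji); by rewrite gbinom0.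
have [j ji mj] : exists2 j, j != i & m j != 0%N.
  apply/exists_inP; apply: contra_notT e; rewrite negb_exists => /forallP h.
  apply/ffunP=> j; rewrite eE; case: eqP => [->//|/eqP ji].
  by have := h j; rewrite ji /= negbK => /eqP.
rewrite (bigD1 j) //= dE (negbTE ji); move: mj; case: (m j) => // a _.
by rewrite gbinom0l mul0r mulr0.
Qed.

Lemma axis_factor_pos i a : exists r f g, 1 - E ((Posz a.+1) *: varpi i) = X i ^+ r * f /\ f * g = 1.
Proof.
(* The exponent [r] is the least positive degree whose binomial coefficient survives in [k]; the top
   coefficient 1 shows that there is one. In characteristic p it is the p-part of [a + 1]. *)
pose P r := (0 < r)%N && ((gbinom (Posz a.+1) r)%:~R != 0 :> k).
have exP : exists r, P r by exists a.+1; rewrite /P /= binn oner_eq0.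
case: (ex_minnP exP) => r /andP[r0 cr] rmin.
have hmon m : (1 - E ((Posz a.+1) *: varpi i)) m =
  if m == ei i *+ m i then - (if m i == 0%N then 0 else (gbinom (Posz a.+1) (m i))%:~R) else 0.
  rewrite psBE ps_e_axis -ps1E constE; case: (m =P ei i *+ m i) => [e|e].
    case: (m i =P 0%N) => [e0|ne0].
      have -> : m = 0 by rewrite e e0.
      by rewrite eqxx zeromE gbinom0 subrr oppr0.
    by rewrite ifF ?sub0r //; apply/eqP => m0; case: ne0; rewrite m0 zeromE.
  by rewrite subr0 ifF //; apply/eqP => m0; case: e; rewrite m0 zeromE mulr0n.
have [f hf] : exists f, 1 - E ((Posz a.+1) *: varpi i) = mon k (ei i *+ r) * f.
  apply: mon_dvdP => m hm; rewrite hmon; case: eqP => // e.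
  case: eqP => [_|/eqP mi0]; first by rewrite oppr0.
  case: (ltnP (m i) r) => h; last first.
    by have /eqP[] := hm (ei i *+ (m i - r)); rewrite -mulrnDr subnKC.
  have : ~~ P (m i) by apply: contraL h => /rmin; rewrite leqNgt.
  by rewrite /P lt0n mi0 /= negbK => /eqP ->; rewrite oppr0.
have f0 : f 0 != 0.
  rewrite -(mon_mulE (ei i *+ r) f) -hf addr0 hmon.
  have -> : (ei i *+ r) i = r.
    by elim: (r) => [|e IH]; rewrite ?zeromE // mulrS addmE IH ffunE eqxx.
  by rewrite eqxx -[r == _]negbK -lt0n r0 oppr_eq0.
have [g fg] := ps_inv f0.
by exists r, f, g; split=> //; rewrite hf monX.
Qed.

Lemma ps_1Be_opp v : 1 - E (- v) = - E (- v) * (1 - E v).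
Proof. by rewrite mulrBr mulr1 !mulNr ps_eNl opprK addrC. Qed.

Lemma axis_factor i (d : int) : d != 0 ->
  exists r f g, 1 - E (d *: varpi i) = X i ^+ r * f /\ f * g = 1.
Proof.
case: d => [[//|a] _|a _]; first exact: axis_factor_pos.
have [r [f [g [e fg]]]] := axis_factor_pos i a.
exists r, (- E (- (Posz a.+1 *: varpi i)) * f), (- E (Posz a.+1 *: varpi i) * g); split.
  by rewrite NegzE scaleNr ps_1Be_opp e mulrCA.
by rewrite mulrACA mulrNN ps_eNl mul1r.
Qed.

(** The Smith normal form of the column [v] supplies the change of coordinates. As lattice
    automorphisms act on the power series, questions about [1 - E v] reduce to a power of one
    variable. *)
Lemma unimodular_axis v : v != 0 -> exists (L L' : 'M[int]_n) i (d : int),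
  [/\ L *m L' = 1%:M, L' *m L = 1%:M, d != 0 & L' *m v = d *: varpi i].
Proof.
move=> v0; have [L uL [R uR [d _ vE]]] := int_Smith_normal_form v.
have n0 : (0 < n)%N.
  by case: (posnP n) => // n0; case/eqP: v0; apply/colP=> i; have := ltn_ord i; rewrite {2}n0.
pose i0 := Ordinal n0.
have DE : (\matrix_(i < n, j < 1) (d`_i *+ (i == j :> nat))) *m R = (d`_0 * R 0 0) *: varpi i0.
  apply/colP=> i; rewrite !mxE big_ord1 !mxE eqxx andbT /=.
  rewrite (_ : (i == i0) = (i == 0 :> nat)) //; case: eqP => [->|]; last by rewrite mulr0n mul0r mulr0.
  by rewrite mulr1n mulr1.
have Lv : invmx L *m v = (d`_0 * R 0 0) *: varpi i0.
  by rewrite {1}vE -mulmxA mulKmx.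
exists L, (invmx L), i0, (d`_0 * R 0 0); split; rewrite ?mulmxV ?mulVmx //.
apply: contraNneq v0 => d0; have := congr1 (mulmx L) Lv.
by rewrite mulKVmx // d0 scale0r mulmx0 => ->.
Qed.

Lemma ps_1Be_reg v g : v != 0 -> (1 - E v) * g = 0 -> g = 0.
Proof.
move=> /unimodular_axis[L [L' [i [d [LL' _ d0 vE]]]]] h.
have [r [f [f' [fE ff]]]] := axis_factor i d0.
have := congr1 (ps_act L') h; rewrite rmorphM rmorphB rmorph1 rmorph0 /= act_ps_e vE fE -mulrA.
move/XiX_reg => /(congr1 ( *%R f')); rewrite mulrA [f' * f]mulrC ff mul1r mulr0.
by move/(congr1 (ps_act L)); rewrite act_mul LL' act_1 rmorph0.
Qed.

Definition free_of i f := forall m, m i != 0%N -> f m = 0.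

Lemma free_ofM i f g : free_of i f -> free_of i g -> free_of i (f * g).
Proof.
move=> hf hg m mi; rewrite (psME _ _ (below_mdeg (leqnn (mdeg m)))) big1 // => a _.
rewrite big1 // => b /eqP e; have [a0|a0] := eqVneq (a i) 0%N; last by rewrite hf ?mul0r.
by rewrite hg ?mulr0 //; apply: contraNneq mi => b0; rewrite -e addmE a0 b0.
Qed.

Lemma free_of_1Be i v : v i 0 = 0 -> free_of i (1 - E v).
Proof.
move=> vi m mi; rewrite psBE -ps1E constE ifF; last first.
  by apply/eqP => m0; case/eqP: mi; rewrite m0 zeromE.
rewrite /ps_e /ps_exp (bigD1 i) // vi; move: mi; case: (m i) => // a _.
by rewrite gbinom0l /= mul0r subr0.
Qed.

Lemma Xi_mul_free i f m : m i = 0%N -> (X i * f) m = 0.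
Proof.
by move=> mi; rewrite mon_mulE0 // => d; apply: contraPneq mi => <-; rewrite addmE ffunE eqxx.
Qed.

Lemma Xi_dvdP i f : (forall m, m i = 0%N -> f m = 0) -> exists q, f = X i * q.
Proof.
move=> h; apply: mon_dvdP => m hm; apply: h; apply/eqP; apply: contraT => mi.
have /eqP[] := hm [ffun j => (m j - (j == i))%N].
apply/ffunP=> j; rewrite addmE !ffunE; case: eqP => [->|]; first by rewrite subnKC // lt0n.
by rewrite subn0.
Qed.

(** Argue modulo [X i]: there [E v] becomes [E v1], with the entry of [v] at [i] erased, and [g]
    becomes its part [g0] free of the variable. The product [(1 - E v1) * g0] is both free of [X i]
    and divisible by it, hence zero; [v1] is nonzero because of the entry at [j], so [g0]
    vanishes. *)
Lemma Xi_coprime_1Be i j v g h : j != i -> v j 0 != 0 ->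
  (1 - E v) * g = X i * h -> exists q, g = X i * q.
Proof.
move=> ji vj e; pose v1 := v - v i 0 *: varpi i.
have v1i : v1 i 0 = 0 by rewrite !mxE !eqxx mulr1 subrr.
have v1N : v1 != 0.
  by apply: contraNneq vj => /colP/(_ j)/eqP; rewrite !mxE (negbTE ji) mulr0 subr0.
have [t tE] : exists t, E (v i 0 *: varpi i) - 1 = X i * t.
  apply: Xi_dvdP => m mi; rewrite psBE ps_e_axis mi mulr0n gbinom0 -ps1E constE.
  by case: eqP; rewrite subrr.
have [h' e'] : exists h', (1 - E v1) * g = X i * h'.
  exists (h + t * E v1 * g); rewrite mulrDr -e !mulrA -tE [(_ - 1) * _]mulrBl mul1r -ps_eD.
  by rewrite [_ + v1]addrC subrK -mulrDl addrA subrK.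
pose g0 : ps k n := fun m => if m i == 0%N then g m else 0.
have [g1 g1E] : exists g1, g - g0 = X i * g1.
  by apply: Xi_dvdP => m mi; rewrite psBE /g0 mi eqxx subrr.
have g0f : free_of i g0 by move=> m mi; rewrite /g0 (negbTE mi).
have g0E : (1 - E v1) * g0 = X i * (h' - (1 - E v1) * g1).
  by rewrite mulrBr -e' mulrCA -g1E -mulrBr opprB [g + _]addrC subrK.
have g00 : g0 = 0.
  apply: (ps_1Be_reg v1N); apply/funext=> m; rewrite ps0E.
  have [mi|mi] := eqVneq (m i) 0%N; first by rewrite g0E Xi_mul_free.
  by apply: (free_ofM (free_of_1Be v1i) g0f).
by exists g1; rewrite -g1E g00 subr0.
Qed.

Lemma XiX_coprime_1Be i j v r g h : j != i -> v j 0 != 0 ->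
  (1 - E v) * g = X i ^+ r * h -> exists q, g = X i ^+ r * q.
Proof.
move=> ji vj; elim: r g h => [|r IH] g h e; first by exists g; rewrite mul1r.
have [q qE] := Xi_coprime_1Be ji vj (etrans e (etrans (congr1 ( *%R^~ h) (exprS _ _)) (esym (mulrA _ _ _)))).
have [q' q'E] : exists q', q = X i ^+ r * q'.
  apply: (IH _ h); apply: (@mon_mul_inj _ _ (ei i)); rewrite -/(X i) mulrCA -qE e exprS.
  by rewrite mulrA.
by exists q'; rewrite qE q'E exprS mulrA.
Qed.

Lemma ps_1Be_coprime u v g h : v != 0 ->
  (forall a b : int, a *: u = b *: v -> a = 0) ->
  (1 - E u) * g = (1 - E v) * h -> exists q, g = (1 - E v) * q.
Proof.
move=> v0 uv e; have [L [L' [i [d [LL' L'L d0 vE]]]]] := unimodular_axis v0.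
have [r [f [f' [fE ff]]]] := axis_factor i d0.
(* In the coordinates adapted to [v], the vector [u] leaves the axis [i]; otherwise [d *: u] would
   be a multiple of [v], against independence. *)
have [j ji uj] : exists2 j, j != i & (L' *m u) j 0 != 0.
  apply/exists_inP; apply: contraNT d0; rewrite negb_exists => /forallP hu.
  apply/eqP/(uv _ ((L' *m u) i 0)); rewrite -[u in LHS]mul1mx -LL' -mulmxA.
  rewrite -[v in RHS]mul1mx -LL' -mulmxA vE [LHS]scalemxAr [RHS]scalemxAr; congr (L *m _).
  move: (L' *m u) hu => u' hu; apply/colP=> j; rewrite !mxE eqxx andbT.
  case: eqP => [->|/eqP ji]; first by rewrite mulr1 mulrC.
  by have := hu j; rewrite ji /= negbK => /eqP ->; rewrite !mulr0.
have := congr1 (ps_act L') e; rewrite !rmorphM !rmorphB !rmorph1 /= !act_ps_e vE fE -mulrA.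
move/(XiX_coprime_1Be ji uj) => [q qE].
exists (ps_act L (f' * q)); rewrite -[LHS]act_1 -LL' -act_mul qE.
have -> : 1 - E v = ps_act L (1 - E (d *: varpi i)).
  by rewrite -vE rmorphB rmorph1 /= act_ps_e mulmxA LL' mul1mx.
by rewrite fE -rmorphM /= -mulrA; congr (ps_act L (_ * _)); rewrite mulrA ff mul1r.
Qed.

(** Only the i-th variable moves, from [x] to [y], so each monomial contributes a multiple of
    [x ^+ e - y ^+ e], divisible by [x - y]; the quotients are summed coefficientwise. *)
Lemma act_dvd w i f : (forall j, j != i -> w *m varpi j = varpi j) ->
  exists q, f - ps_act w f = (E (varpi i) - E (w *m varpi i)) * q.
Proof.
move=> hw; have yX j : j != i -> wvar k w j = X j.
  by move=> /hw e; rewrite wvarE e ps_e_varpi0 addrC addKr.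
set x := X i; set y := wvar k w i.
have y1 := @ord_wvar k n w; have x1 := @ord_Xi k n.
pose T m := (\prod_(j | j != i) X j ^+ m j) * \sum_(e < m i) x ^+ ((m i).-1 - e) * y ^+ e.
have ordT m : ord_ge (mdeg m).-1 (T m).
  rewrite /T /mdeg (bigD1 i) //=; case: (m i) => [|e].
    by rewrite big_ord0 mulr0 => p _; rewrite ps0E.
  rewrite addSn /= addnC; apply: ord_geM.
    apply: (big_ind2 (fun d f => ord_ge d f)) => //; first by move=> d f1 e1 g1; apply: ord_geM.
    by move=> j _; have := ord_geX (e := m j) (x1 j); rewrite mul1n.
  move=> p hp; rewrite ps_sumE big1 // => j _.
  have := ord_geM (ord_geX (e := e - j) (x1 i)) (ord_geX (e := j) (y1 i)).
  by rewrite !mul1n subnK -1?ltnS //; apply.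
have sT : summable 1 (fun m => C (f m) * T m).
  by move=> m p; rewrite addn1 => h; rewrite constM_coef ordT ?mulr0 // -ltnS; case: (mdeg m) h.
exists (psum 1 (fun m => C (f m) * T m)).
have -> : E (varpi i) - E (w *m varpi i) = x - y.
  by rewrite /y wvarE ps_e_varpi0 opprB addrA [1 + _]addrC.
rewrite mul_psum //; apply/funext=> p; rewrite psBE ps_actE.
rewrite (mon_sum_local f (leq_addr 1 _)) (substE y1 f (leq_addr 1 _)) -psBE -sumrB ps_sumE /psum.
apply: eq_bigr => m _; rewrite -mulrBr.
have -> : mon k m - ymon (wvar k w) m = (x - y) * T m; last by rewrite mulrCA.
rewrite mon_prod /ymon (bigD1 i) // [X in _ - X](bigD1 i) //= -/x -/y.
rewrite [X in _ - _ * X](eq_bigr (fun j => X j ^+ m j)) => [|j ji]; last by rewrite yX.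
by rewrite -mulrBl subrXX mulrC /T mulrCA.
Qed.

End Divisibility.

(** * The numbers game *)

(* Only used for a * b <= 3: the order of s_i s_j in terms of the Cartan integers. *)
Definition coxeter_exp (a b : int) : nat :=
  match absz (a * b) with 0 => 2 | 1 => 3 | 2 => 4 | _ => 6 end.

Section Cartan.
Variables (n : nat) (A : 'M[int]_n).
Hypothesis hA : is_finite_cartan A.
Implicit Types (i j : 'I_n) (c : 'rV[int]_n) (s t : seq 'I_n).

Lemma cartan_diag i : A i i = 2. Proof. by case: hA. Qed.

Lemma cartan_rank2 i j : i != j -> (A i j, A j i) \in
  ([:: (0, 0); (-1, -1); (-1, -2); (-2, -1); (-1, -3); (-3, -1)] : seq (int * int)).
Proof.
move=> ij; case: hA => diag npos zero [d [d0 sym pos]].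
have aij := npos _ _ ij; have aji := npos j i; rewrite eq_sym in aji; have {}aji := aji ij.
(* (- d_i A_ij, 2 d_i) is the minimizer of the form in the plane of i and j, up to scale. *)
pose x (l : 'I_n) : rat := if l == i then - (d i * (A i j)%:~R) else if l == j then 2 * d i else 0.
have /pos : exists l, x l != 0.
  by exists j; rewrite /x (eq_sym j) (negbTE ij) eqxx mulf_neq0 // lt0r_neq0.
have xi : x i = - (d i * (A i j)%:~R) by rewrite /x eqxx.
have xj : x j = 2 * d i by rewrite /x (eq_sym j) (negbTE ij) eqxx.
have x0 l : l != i -> l != j -> x l = 0 by rewrite /x => /negbTE-> /negbTE->.
have two (F : 'I_n -> rat) : (forall l, l != i -> l != j -> F l = 0) -> \sum_l F l = F i + F j.
  move=> h; rewrite (bigD1 i) //= (bigD1 j) ?(eq_sym j) //= big1 ?addr0 // => l /andP[? ?].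
  exact: h.
rewrite two => [|l li lj]; last by rewrite big1 // => m _; rewrite x0 // !mul0r.
rewrite !two => [|l li lj|l li lj]; try by rewrite (x0 l) // mulr0.
rewrite xi xj !diag => h.
have dj := d0 j; have di := d0 i.
have prod : A i j * A j i < 4.
  rewrite -(ltr_int rat) intrM -subr_gt0.
  have : 0 < 2 * d i ^+ 2 * d j * (4 - (A i j)%:~R * (A j i)%:~R).
    by move: h; congr (0 < _); ring.
  by rewrite pmulr_rgt0 // !mulr_gt0 ?exprn_gt0.
have z := zero i j; rewrite !inE !xpair_eqE.
have : A i j = 0 \/ A i j <= -1 by lia.
case=> [e|h1].
  by move: z; rewrite e eqxx => /esym/eqP ->.
have h2 : A j i <= -1 by move: z; case: eqP; case: eqP; lia.
have : A i j >= -3 by nia.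
have : A j i >= -3 by nia.
move: h1 h2 prod; case: (A i j) => [?|[|[|[|?]]]]; case: (A j i) => [?|[|[|[|?]]]]; lia.
Qed.

(* The state c stands for the point (1,...,1) - sum_l c_l alpha_l of the Weyl group orbit of
   (1,...,1); chip c i is its i-th coordinate, so that firing i is the simple reflection s_i. *)
Definition chip c i : int := 1 - (c *m A) 0 i.
Definition fire i c : 'rV[int]_n := c + chip c i *: delta_mx 0 i.
Definition height c : int := \sum_l c 0 l.

Lemma chip_add c (x : int) i j : chip (c + x *: delta_mx 0 i) j = chip c j - x * A i j.
Proof. by rewrite /chip mulmxDl -scalemxAl -rowE !mxE opprD addrA. Qed.

Lemma chip_fire c i j : chip (fire i c) j = chip c j - chip c i * A i j.
Proof. exact: chip_add. Qed.

Lemma chip_fire_same c i : chip (fire i c) i = - chip c i.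
Proof. by rewrite chip_fire cartan_diag; lia. Qed.

Lemma fireK i : involutive (fire i).
Proof.
move=> c; rewrite {1}/fire chip_fire_same /fire -addrA -scalerDl subrr scale0r.
by rewrite addr0.
Qed.

Lemma chip0 i : chip 0 i = 1.
Proof. by rewrite /chip mul0mx mxE subr0. Qed.

Lemma height_fire i c : height (fire i c) = height c + chip c i.
Proof.
rewrite /height /fire (eq_bigr (fun l => c 0 l + chip c i * (l == i)%:Z)) => [|l _].
  rewrite big_split /=; congr (_ + _); rewrite (bigD1 i) //= eqxx mulr1 big1 ?addr0 // => l /negbTE->.
  by rewrite mulr0.
by rewrite !mxE eqxx; case: (l == i).
Qed.

Lemma height0 : height 0 = 0.
Proof. by rewrite /height big1 // => l _; rewrite mxE. Qed.

(** The list leads from [c] back to the start 0, each reflection making a negative coordinate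
    positive. It acts as a reduced word for the group element that [c] represents. *)
Fixpoint legal s c : Prop :=
  if s is i :: s' then chip c i < 0 /\ legal s' (fire i c) else c = 0.

Lemma height_legal s c : legal s c -> (size s)%:Z <= height c.
Proof.
elim: s c => [|i s IH] c /=; first by move=> ->; rewrite height0.
by move=> [ci /IH]; rewrite height_fire; lia.
Qed.

Lemma legal_fire s c i : legal s c -> 0 < chip c i -> legal (i :: s) (fire i c).
Proof. by move=> h ci /=; rewrite fireK chip_fire_same oppr_lt0. Qed.

Section Plane.
Variables (c : 'rV[int]_n) (i j : 'I_n).
Definition plane (x y : int) : 'rV[int]_n := c + x *: delta_mx 0 i + y *: delta_mx 0 j.

Lemma chip_planel x y : chip (plane x y) i = chip c i - x * 2 - y * A j i.
Proof. by rewrite !chip_add cartan_diag. Qed.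

Lemma chip_planer x y : chip (plane x y) j = chip c j - x * A i j - y * 2.
Proof. by rewrite !chip_add cartan_diag. Qed.

Lemma fire_planel x y : fire i (plane x y) = plane (chip c i - x - y * A j i) y.
Proof.
rewrite /fire chip_planel /plane [LHS]addrAC; congr (_ + _).
rewrite -[LHS]addrA -scalerDl; congr (_ + _ *: _); ring.
Qed.

Lemma fire_planer x y : fire j (plane x y) = plane x (chip c j - x * A i j - y).
Proof.
rewrite /fire chip_planer /plane -[LHS]addrA -scalerDl; congr (_ + _ *: _); ring.
Qed.

Lemma plane00 : plane 0 0 = c.
Proof. by rewrite /plane !scale0r !addr0. Qed.
End Plane.

Fixpoint walk i j m c := if m is m'.+1 then walk j i m' (fire i c) else c.
Fixpoint neg_walk i j m c : Prop :=
  if m is m'.+1 then chip c i < 0 /\ neg_walk j i m' (fire i c) else True.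
Fixpoint altw i j m : seq 'I_n := if m is m'.+1 then i :: altw j i m' else [::].

(** The alternating firings run along the two sides of a polygon with [2 * m] vertices, the orbit of
    a regular point under the dihedral group of [i] and [j]. For each of the six pairs of Cartan
    integers this is linear arithmetic in the plane of [i] and [j]. *)
Lemma polygon i j c : i != j -> chip c i < 0 -> chip c j < 0 ->
  let m := coxeter_exp (A i j) (A j i) in
  neg_walk i j m c /\ walk i j m c = walk j i m c.
Proof.
move=> ij ci cj; rewrite -(plane00 c i j); move: (cartan_rank2 ij); rewrite !inE.
do ![case/orP]; case/eqP => e1 e2;
  rewrite e1 e2 /= !(fire_planel, fire_planer, chip_planel, chip_planer) e1 e2 /=;
  (split; last by congr plane; lia); repeat split; lia.
Qed.

(** On a wall the polygon degenerates: [m - 1] firings lead to another wall. A zero chip is thus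
    carried to lower states, which is the descent behind [chip_neq0]. *)
Lemma polygon0 i j c : i != j -> chip c i = 0 -> chip c j < 0 ->
  let m := (coxeter_exp (A i j) (A j i)).-1 in
  neg_walk j i m c /\ (chip (walk j i m c) i = 0 \/ chip (walk j i m c) j = 0).
Proof.
move=> ij ci cj; rewrite -(plane00 c i j); move: (cartan_rank2 ij); rewrite !inE.
do ![case/orP]; case/eqP => e1 e2;
  rewrite e1 e2 /= !(fire_planel, fire_planer, chip_planel, chip_planer) e1 e2 /=;
  (split; [repeat split; lia | lia]).
Qed.

Lemma legal_altw i j m t c : neg_walk i j m c -> legal t (walk i j m c) -> legal (altw i j m ++ t) c.
Proof. by elim: m i j c => [|m IH] i j c //= [ci nw] h; split=> //; apply: IH. Qed.

End Cartan.

Section Bound.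
Variables (n : nat) (A : 'M[int]_n).
Hypothesis hA : is_finite_cartan A.

(* The states lie on an ellipsoid N(c - y) = N(y) for the positive definite form N given by A. *)
Lemma height_bounded : exists N : nat, forall s c, legal A s c -> height c <= N%:Z.
Proof.
case: (hA) => diag _ _ [d [d0 sym pos]].
have dn0 i : d i != 0 by rewrite lt0r_neq0.
pose B : 'M[rat]_n := \matrix_(i, j) ((A i j)%:~R / d j).
have Bsym : B^T = B.
  apply/matrixP=> i j; rewrite !mxE; apply: (mulIf (dn0 i)); rewrite divfK //.
  by apply: (mulfI (dn0 j)); rewrite sym; field.
pose N2 (x y : 'rV[rat]_n) : rat := (x *m B *m y^T) 0 0.
have N2E x : N2 x x = \sum_i \sum_j (x 0 i / d i) * d i * (A i j)%:~R * (x 0 j / d j).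
  rewrite /N2 mxE exchange_big /=; apply: eq_bigr => j _; rewrite !mxE mulr_suml.
  by apply: eq_bigr => i _; rewrite !mxE divfK // -!mulrA; congr (_ * (_ * _)); rewrite mulrC.
have N2pos x : x != 0 -> 0 < N2 x x.
  move=> x0; rewrite N2E; apply: (pos (fun i => x 0 i / d i)).
  apply/existsP; apply: contraNT x0; rewrite negb_exists => /forallP h.
  apply/eqP/rowP=> i; have := h i; rewrite negbK mulf_eq0 invr_eq0 (negbTE (dn0 i)) orbF mxE.
  by move/eqP.
have N2ge x : 0 <= N2 x x.
  have [->|x0] := eqVneq x 0; last exact/ltW/N2pos.
  by rewrite /N2 !mul0mx mxE.
have N2C x y : N2 x y = N2 y x.
  rewrite /N2 -[in LHS](trmxK (x *m B *m y^T)) [LHS]mxE !trmx_mul trmxK Bsym mulmxA //.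
have N2D x y z : N2 (x + y) z = N2 x z + N2 y z by rewrite /N2 !mulmxDl mxE.
have N2Z a x z : N2 (a *: x) z = a * N2 x z by rewrite /N2 -!scalemxAl mxE.
have N2Dr x x' x'' : N2 x (x' + x'') = N2 x x' + N2 x x'' by rewrite N2C N2D !(N2C x).
have N2Zr a x x' : N2 x (a *: x') = a * N2 x x' by rewrite N2C N2Z (N2C x).
have uB : B \in unitmx.
  rewrite -row_free_unit -kermx_eq0; apply/eqP/row_matrixP => i; rewrite row0.
  apply/eqP; apply: contraT => x0; have := N2pos _ x0.
  by rewrite /N2 -row_mul mulmx_ker row0 mul0mx mxE ltxx.
(* The vector [y] gives the coordinates of (1,...,1) in the simple coroots, so [q c - y] is the
   orbit point up to sign and [N2] its squared length; [z] represents the height as a linear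
   form. *)
pose e : 'rV[rat]_n := \row_l (d l)^-1.
pose y := e *m invmx B.
pose z := (const_mx 1 : 'rV[rat]_n) *m invmx B.
pose q (c : 'rV[int]_n) : 'rV[rat]_n := map_mx intr c.
have N2y x : N2 x y = \sum_l x 0 l / d l.
  rewrite N2C /N2 /y mulmxKV // mxE; by apply: eq_bigr => l _; rewrite !mxE mulrC.
have N2z x : N2 x z = \sum_l x 0 l.
  rewrite N2C /N2 /z mulmxKV // mxE; by apply: eq_bigr => l _; rewrite !mxE mul1r.
have inv s c : legal A s c -> N2 (q c) (q c) = 2 * N2 (q c) y.
  elim: s c => [|i s IH] c /=.
    by move=> ->; rewrite /q map_mx0 /N2 !mul0mx !mxE mulr0.
  case=> _ /IH; set p : rat := (chip A c i)%:~R.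
  have -> : q (fire A i c) = q c + p *: delta_mx 0 i.
    by apply/rowP=> l; rewrite !mxE rmorphD rmorphM /= natz; case: (l == i).
  have N2d x : N2 x (delta_mx 0 i) = (x *m B) 0 i.
    rewrite /N2 trmx_delta -colE mxE //.
  have hq : N2 (q c) (delta_mx 0 i) = (1 - p) / d i.
    rewrite N2d mxE /p /chip mxE rmorphB rmorph1 opprB addrC subrK rmorph_sum mulr_suml.
    by apply: eq_bigr => l _; rewrite !mxE rmorphM /= mulrA.
  have hd : N2 (delta_mx 0 i) (delta_mx 0 i) = 2 / d i.
    by rewrite N2d -rowE !mxE diag.
  have hy : N2 (delta_mx 0 i) y = (d i)^-1.
    rewrite N2y (bigD1 i) //= big1 ?addr0 => [|l li]; rewrite mxE ?eqxx ?mul1r //.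
    by rewrite (negbTE li) mul0r.
  rewrite !(N2D, N2Dr, N2Z, N2Zr) (N2C (delta_mx 0 i) (q c)) hq hd hy => h.
  move/eqP: h; rewrite -subr_eq0 => h; apply/eqP; rewrite -subr_eq0.
  by move: h; congr (_ == _); field.
have ell s c : legal A s c -> N2 (q c - y) (q c - y) = N2 y y.
  by move=> /inv h; rewrite -scaleN1r !(N2D, N2Dr, N2Z, N2Zr) h (N2C y (q c)); ring.
have CS x x' : N2 x x' ^+ 2 <= N2 x x * N2 x' x'.
  have [->|x0] := eqVneq x' 0.
    by rewrite N2C /N2 !mul0mx !mxE mulr0 expr0n.
  have a0 := N2pos _ x0; have := N2ge (N2 x' x' *: x + - N2 x x' *: x').
  rewrite !(N2D, N2Dr, N2Z, N2Zr) (N2C x' x) => h.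
  rewrite -subr_ge0 -(pmulr_rge0 _ a0); move: h; congr (0 <= _); ring.
(* Cauchy-Schwarz gives [S ^+ 2 <= K] for the varying part [S] of the height; since
   [S <= S ^+ 2 + 1], the bound [K + 1] avoids square roots. *)
pose K := N2 y y * N2 z z; pose M := `|K + 1 + \sum_l y 0 l|.
exists (Num.bound M) => s c lc.
have : (height c)%:~R <= M :> rat.
  have hc : (height c)%:~R = N2 (q c - y) z + \sum_l y 0 l.
    rewrite N2z -big_split /height rmorph_sum; apply: eq_bigr => l _.
    have -> : (q c - y) 0 l = q c 0 l - y 0 l by rewrite !mxE.
    by rewrite /= subrK mxE.
  apply: le_trans (ler_norm _); rewrite hc lerD2r.
  have := CS (q c - y) z; rewrite (ell _ _ lc) -/K; set S := N2 _ z => h.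
  have := sqr_ge0 (S - 1); have := sqr_ge0 S; rewrite sqrrB expr1n; nra.
move=> h; rewrite -(ler_int rat); apply: le_trans h _.
by apply/ltW/archi_boundP/normr_ge0.
Qed.

End Bound.

(** * Vanishing of Hecke modules *)

Section Game.
Variables (n : nat) (A : 'M[int]_n).
Hypothesis hA : is_finite_cartan A.
(* sim is equality of vectors; eqv, below, is equality modulo a submodule. *)
Variables (X : Type) (V : X -> Prop) (sim : X -> X -> Prop) (D : 'I_n -> X -> X).
Hypotheses (VD : forall i x, V x -> V (D i x))
  (sim_refl : forall x, sim x x)
  (sim_sym : forall x y, sim x y -> sim y x)
  (sim_trans : forall x y z, sim x y -> sim y z -> sim x z)
  (sim_D : forall i x y, V x -> V y -> sim x y -> sim (D i x) (D i y))
  (D_idem : forall i x, V x -> sim (D i (D i x)) (D i x)).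

Definition dwords (s : seq 'I_n) x := foldr D x s.
Hypothesis braid : forall i j x, i != j -> V x ->
  sim (dwords (altw i j (coxeter_exp (A i j) (A j i))) x) (dwords (altw j i (coxeter_exp (A i j) (A j i))) x).

Lemma dwords_stable s x : V x -> V (dwords s x).
Proof. by move=> Vx; elim: s => //= i s; apply: VD. Qed.

Lemma dwords_cat s t x : dwords (s ++ t) x = dwords s (dwords t x).
Proof. exact: foldr_cat. Qed.

Definition sim_words s t := forall x, V x -> sim (dwords s x) (dwords t x).

(** Peels an alternating word off [s] letter by letter, given the exchange property below height
    [N]; firing a negative chip lowers the height, so the assumption stays available. *)
Lemma descend (N : int) :
  (forall s c i, height c < N -> legal A s c -> chip A c i < 0 ->
     exists t, legal A (i :: t) c /\ sim_words s (i :: t)) ->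
  forall m i j s c, height c < N -> legal A s c -> neg_walk A i j m c ->
  exists t, legal A t (walk A i j m c) /\ sim_words s (altw i j m ++ t).
Proof.
move=> IH; elim=> [|m IHm] i j s c hc ls /=.
  by move=> _; exists s; split=> // x _; apply: sim_refl.
move=> [ci nw]; have [t [[_ lt] st]] := IH _ _ _ hc ls ci.
have hc1 : height (fire A i c) < N by rewrite height_fire; lia.
have [t' [lt' st']] := IHm _ _ _ _ hc1 lt nw.
exists t'; split=> // x Vx; apply: sim_trans (st x Vx) _ => /=.
by apply: sim_D; [exact: dwords_stable|exact: dwords_stable|exact: st'].
Qed.

Lemma coxeter_exp_sym a b : coxeter_exp a b = coxeter_exp b a.
Proof. by rewrite /coxeter_exp mulrC. Qed.

Lemma coxeter_expS a b : exists m, coxeter_exp a b = m.+1.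
Proof. by rewrite /coxeter_exp; case: absz => [|[|[|m]]]; eexists. Qed.

(** The exchange property, in the manner of Matsumoto. If [s] begins with [j] and [i] is a descent
    too, follow the side of the polygon that starts with [j]: there [s] becomes an alternating word
    followed by some [t]. The braid relation trades this word for the other side, which ends at the
    same state. *)
Lemma legal_descent s c i : legal A s c -> chip A c i < 0 ->
  exists t, legal A (i :: t) c /\ sim_words s (i :: t).
Proof.
have [N hN] : exists N : nat, height c < N%:Z by exists (absz (height c)).+1; lia.
elim: N s c i hN => [|N IH] s c i hc ls ci.
  by have := height_legal ls; lia.
case: s ls => [/= c0|j s [cj ls]]; first by move: ci; rewrite c0 chip0.
have [<-|ij] := eqVneq j i.
  by exists s; split=> // x _; apply: sim_refl.
have hc1 : height (fire A j c) < N%:Z by rewrite height_fire; lia.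
have [nji wji] := polygon hA ij cj ci.
rewrite eq_sym in ij; have [nij _] := polygon hA ij ci cj.
have brd := braid ij; rewrite coxeter_exp_sym in nji wji.
have [m em] := coxeter_expS (A i j) (A j i); rewrite em in nji wji nij brd.
case: nji => _ nji; have [t [lt st]] := descend IH hc1 ls nji.
exists (altw j i m ++ t); split.
  by apply: (@legal_altw _ _ i j m.+1) => //; rewrite -wji.
move=> x Vx; have Vt := dwords_stable t Vx.
apply: sim_trans (_ : sim _ (dwords (altw j i m.+1) (dwords t x))) _.
  by rewrite -dwords_cat /=; apply: sim_D; [exact: dwords_stable|exact: dwords_stable|exact: st].
apply: sim_trans (sim_sym (brd _ Vt)) _.
by rewrite -dwords_cat; apply: sim_refl.
Qed.

Lemma chip_neq0 s c i : legal A s c -> chip A c i != 0.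
Proof.
have [N hN] : exists N : nat, height c < N%:Z by exists (absz (height c)).+1; lia.
elim: N s c i hN => [|N IH] s c i hc ls.
  by have := height_legal ls; lia.
case: s ls => [/= ->|j s [cj ls]]; first by rewrite chip0.
have [<-|ij] := eqVneq j i; first by rewrite lt_eqF.
apply/eqP => ci; rewrite eq_sym in ij; have := polygon0 hA ij ci cj.
have [m ->] : exists m, (coxeter_exp (A i j) (A j i)).-1 = m.+1.
  by rewrite /coxeter_exp; case: absz => [|[|[|?]]]; eexists.
move=> [[_ nw] w0]; have hc1 : height (fire A j c) < N%:Z by rewrite height_fire; lia.
have step : forall m i j s c, height c < N%:Z -> legal A s c -> neg_walk A i j m c ->
    forall l, chip A (walk A i j m c) l != 0.
  elim=> [|m' IHm] i' j' s' c' h' l' /=; first by move=> _ l; apply: (IH s').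
  move=> [ci' nw'] l; have [t [[_ lt] _]] := legal_descent l' ci'.
  by apply: (IHm _ _ t) => //; rewrite height_fire; lia.
have h := step m i j s _ hc1 ls nw.
by case: w0 => /eqP; apply/negP; apply: h. 
Qed.

Lemma longest_legal : exists s c, legal A s c /\ forall i, chip A c i < 0.
Proof.
have [N hN] := height_bounded hA.
suff H M s c : legal A s c -> N%:Z - height c < M%:Z ->
    exists s c, legal A s c /\ forall i, chip A c i < 0.
  by apply: (H N.+1 [::] 0) => //; rewrite height0; lia.
elim: M s c => [|M IH] s c ls hc; first by have := hN _ _ ls; lia.
case: (boolP [forall i, chip A c i < 0]) => [/forallP h|].
  by exists s, c.
rewrite negb_forall => /existsP[i ci].
have ci0 : 0 < chip A c i by have := chip_neq0 i ls; lia.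
by apply: (IH _ _ (legal_fire hA ls ci0)); rewrite height_fire; lia.
Qed.

Lemma dwords_fixed s c i x : legal A s c -> chip A c i < 0 -> V x -> sim (D i (dwords s x)) (dwords s x).
Proof.
move=> ls ci Vx; have [t [_ st]] := legal_descent ls ci.
have Vt := dwords_stable t Vx; apply: sim_trans (_ : sim _ (D i (dwords (i :: t) x))) _.
  by apply: sim_D; [exact: dwords_stable|exact: dwords_stable|exact: st].
by apply: sim_trans (D_idem _ Vt) _; apply/sim_sym/st.
Qed.

Variables (eqv : X -> X -> Prop) (zero : X) (Em : 'cV[int]_n -> X -> X).
Hypotheses (eqv_sym : forall x y, eqv x y -> eqv y x)
  (eqv_trans : forall x y z, eqv x y -> eqv y z -> eqv x z)
  (sim_eqv : forall x y, sim x y -> eqv x y)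
  (eqv_D : forall i x y, V x -> V y -> eqv x y -> eqv (D i x) (D i y))
  (VE : forall l x, V x -> V (Em l x))
  (eqv_E0 : forall l x, eqv x zero -> eqv (Em l x) zero)
  (eqv_E : forall l x y, eqv x y -> eqv (Em l x) (Em l y))
  (EN : forall l x, eqv (Em (- l) (Em l x)) x)
  (D_E0 : forall (l : 'cV_n) i x, l i 0 = 0 -> V x -> eqv (D i (Em l x)) (Em l (D i x)))
  (D_E1 : forall (l : 'cV_n) i x, l i 0 = 1 -> V x -> eqv (D i x) zero -> eqv (D i (Em l x)) (Em l x))
  (fixed_zero : forall x, V x -> (forall i, sim (D i x) x) -> eqv x zero).

(** Passes to the longest word [s]: [dwords s x] is still [eqv] to [x], because each letter fixes
    [x] up to [eqv], but it is fixed up to [sim], as [fixed_zero] demands. *)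
Lemma eqv_fixed_zero x : V x -> (forall i, eqv (D i x) x) -> eqv x zero.
Proof.
move=> Vx hx; have [s [c [ls lc]]] := longest_legal.
have hs t : eqv (dwords t x) x.
  elim: t => [|i t IH] /=; first exact/sim_eqv/sim_refl.
  by apply: eqv_trans (hx i); apply: eqv_D => //; apply: dwords_stable.
apply: eqv_trans (eqv_sym (hs s)) _; apply: fixed_zero; first exact: dwords_stable.
by move=> i; apply: (dwords_fixed (c := c)).
Qed.

(* If every legal successor of s sends x to 0, then the weight sum of the varpi_i over the
   ascents i of s turns dwords s x into a vector fixed by all the D i. *)
Lemma hecke_vanishing x : V x -> eqv x zero.
Proof.
move=> Vx; have [N hN] := height_bounded hA.
suff H M s c : legal A s c -> N%:Z - height c < M%:Z -> eqv (dwords s x) zero.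
  by apply: (H N.+1 [::] 0) => //; rewrite height0; lia.
elim: M s c => [|M IH] s c ls hc; first by have := hN _ _ ls; lia.
pose l : 'cV[int]_n := \col_i (if 0 < chip A c i then 1 else 0).
have Vs := dwords_stable s Vx.
suff h0 : eqv (Em l (dwords s x)) zero by apply: eqv_trans (eqv_sym (EN l _)) (eqv_E0 _ h0).
apply: eqv_fixed_zero; first exact: VE.
move=> i; case: (ltP 0 (chip A c i)) => ci.
  apply: D_E1 => //; first by rewrite mxE ci.
  by apply: (IH (i :: s)) (legal_fire hA ls ci) _; rewrite height_fire; lia.
have ci0 : chip A c i < 0 by have := chip_neq0 i ls; lia.
apply: eqv_trans (D_E0 _ _) _ => //; first by rewrite mxE ltNge ci.
by apply/eqv_E/sim_eqv/(dwords_fixed ls).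
Qed.

End Game.

(** * Coroots and reflections *)

Section Weyl.
Variables (n : nat) (A : 'M[int]_n).
Hypothesis hA : is_finite_cartan A.
Implicit Types (i j : 'I_n) (v w : 'M[int]_n).
Local Notation s := (sref A).
Local Notation eps i := (delta_mx 0 i : 'rV[int]_n).

Definition alpha i : 'cV[int]_n := \col_j A i j.

Lemma srefE i : s i = 1%:M - alpha i *m eps i.
Proof.
apply/matrixP=> a b; rewrite !mxE big_ord1 !mxE /= mulrC.
by rewrite [b == i]eq_sym.
Qed.

Lemma sref_mul i (l : 'cV[int]_n) : s i *m l = l - l i 0 *: alpha i.
Proof.
rewrite srefE mulmxBl mul1mx -mulmxA -rowE; congr (_ - _).
by apply/colP=> a; rewrite !mxE big_ord1 !mxE mulrC.
Qed.

Lemma sref_alpha i : s i *m alpha i = - alpha i.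
Proof.
rewrite sref_mul mxE cartan_diag // -{1}[alpha i]scale1r -scalerBl -[RHS]scaleN1r.
by congr (_ *: _).
Qed.

Lemma sref_varpi i j : j != i -> s i *m varpi j = varpi j.
Proof. by move=> ji; rewrite sref_mul !mxE eq_sym (negbTE ji) scale0r subr0. Qed.

Lemma srefK i : s i *m s i = 1%:M.
Proof.
rewrite {2}srefE mulmxBr mulmx1 mulmxA sref_alpha mulNmx opprK srefE.
by rewrite subrK.
Qed.

Lemma alpha_neq0 i : alpha i != 0.
Proof. by apply/eqP => /colP/(_ i)/eqP; rewrite !mxE cartan_diag. Qed.

Lemma in_W1 : in_W A 1%:M. Proof. by exists [::]. Qed.

Lemma in_W_sref i : in_W A (s i). Proof. by exists [:: i]; rewrite /= mulmx1. Qed.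

Lemma in_W_mul v w : in_W A v -> in_W A w -> in_W A (v *m w).
Proof.
move=> [a ->] [b ->]; exists (a ++ b); elim: a => [|i a IH] /=; first by rewrite mul1mx.
by rewrite -IH mulmxA.
Qed.

Lemma in_W_unit v : in_W A v -> v \in unitmx.
Proof.
move=> [a ->]; elim: a => [|i a IH] /=; first exact: unitmx1.
by rewrite unitmx_mul IH andbT; case: (mulmx1_unit (srefK i)).
Qed.

Lemma in_W_inv v : in_W A v -> in_W A (invmx v).
Proof.
move=> Wv; suff [u Wu vu] : exists2 u, in_W A u & v *m u = 1%:M.
  by rewrite -[invmx v]mulmx1 -vu mulKmx ?in_W_unit.
case: Wv => a ->; elim: a => [|i a [u Wu e]] /=.
  by exists 1%:M; rewrite ?mulmx1 //; apply: in_W1.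
exists (u *m s i); first by apply: in_W_mul => //; apply: in_W_sref.
by rewrite mulmxA -[_ *m u]mulmxA e mulmx1 srefK.
Qed.

Lemma in_W_refl v i : in_W A v -> in_W A (v *m s i *m invmx v).
Proof.
move=> Wv; apply: in_W_mul; last exact: in_W_inv.
by apply: in_W_mul => //; apply: in_W_sref.
Qed.

Lemma coroot_neq0 v i : in_W A v -> v *m alpha i != 0.
Proof.
move=> Wv; apply: contraNneq (alpha_neq0 i) => h.
by rewrite -[alpha i](mulKmx (in_W_unit Wv)) h mulmx0.
Qed.

(* The functionals dual to the coroots carry the invariant form (eps_i, eps_j) = d_i A_ij;
   proportional coroots therefore have proportional, hence (by primitivity) equal up to sign, functionals. *)
Lemma coroot_dichotomy v i j (a b : int) : in_W A v -> a != 0 -> a *: alpha i = b *: (v *m alpha j) ->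
  (v *m alpha j = alpha i \/ v *m alpha j = - alpha i) /\ v *m s j *m invmx v = s i.
Proof.
move=> Wv a0 e; case: (hA) => diag _ _ [d [d0 sym pos]].
have uv := in_W_unit Wv; have dn0 l : d l != 0 by rewrite lt0r_neq0.
pose G : 'M[rat]_n := \matrix_(x, y) (d x * (A x y)%:~R).
pose Q m p (M : 'M[int]_(m, p)) : 'M[rat]_(m, p) := map_mx intr M.
have QM m p r (M : 'M[int]_(m, p)) (N : 'M[int]_(p, r)) : Q _ _ (M *m N) = Q _ _ M *m Q _ _ N.
  exact: map_mxM.
have GT : G^T = G by apply/matrixP=> x y; rewrite !mxE sym.
have Galpha l : G *m (Q _ _ (eps l))^T = d l *: Q _ _ (alpha l).
  by rewrite /Q map_delta_mx trmx_delta -colE; apply/colP=> x; rewrite !mxE -sym.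
have Gsref x : Q _ _ (s x) *m G *m (Q _ _ (s x))^T = G.
  have epsG : Q _ _ (eps x) *m G = d x *: (Q _ _ (alpha x))^T.
    by rewrite -[LHS]trmxK trmx_mul GT Galpha linearZ.
  have sG : Q _ _ (s x) *m G = G - d x *: (Q _ _ (alpha x) *m (Q _ _ (alpha x))^T).
    rewrite srefE /Q map_mxB map_mx1 map_mxM mulmxBl mul1mx -mulmxA; congr (_ - _).
    by rewrite -/(Q _ _ (eps x)) epsG -scalemxAr.
  have sGT : (Q _ _ (s x) *m G)^T = Q _ _ (s x) *m G.
    by rewrite sG linearB linearZ /= trmx_mul trmxK GT.
  rewrite -sGT trmx_mul GT -mulmxA -trmx_mul -QM srefK.
  by rewrite /Q map_mx1 trmx1 mulmx1.
have Ginv w : in_W A w -> Q _ _ w *m G *m (Q _ _ w)^T = G.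
  move=> [t ->]; elim: t => [|x t IH] /=.
    by rewrite /Q map_mx1 trmx1 mul1mx mulmx1.
  by rewrite QM trmx_mul -[RHS](Gsref x) -[in RHS]IH !mulmxA.
pose phi := eps j *m invmx v.
have Gphi : G *m (Q _ _ phi)^T = d j *: Q _ _ (v *m alpha j).
  rewrite -{1}(Ginv v Wv) -!mulmxA -trmx_mul -QM /phi mulmxKV // Galpha -scalemxAr.
  by rewrite QM.
(* The coefficients make [G *m x^T] a multiple of [a *: alpha i - b *: (v *m alpha j)], which is
   zero; definiteness then kills [x]. *)
pose x : 'rV[rat]_n := (a%:~R * d j) *: Q _ _ (eps i) - (b%:~R * d i) *: Q _ _ phi.
have Gx : G *m x^T = 0.
  rewrite /x [(_ - _)^T]linearB /= ![(_ *: _)^T]linearZ /= mulmxBr -!scalemxAr Galpha Gphi !scalerA.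
  have QZ (c : int) m p (M : 'M[int]_(m, p)) : Q _ _ (c *: M) = c%:~R *: Q _ _ M by exact: map_mxZ.
  rewrite (_ : a%:~R * d j * d i = d j * d i * a%:~R); last by ring.
  rewrite -[(d j * d i * _) *: _]scalerA -QZ e QZ scalerA -scalerBl.
  by rewrite (_ : _ - _ = 0) ?scale0r //; ring.
have x0 : x = 0.
  apply/eqP; apply: contraT => xn0.
  have := pos (fun l => x 0 l); rewrite (_ : \sum_(_ < _) _ = (x *m (G *m x^T)) 0 0).
    rewrite Gx mulmx0 mxE ltxx => /(_ _); apply.
    apply/existsP; apply: contraNT xn0; rewrite negb_exists => /forallP h.
    by apply/eqP/rowP=> l; have := h l; rewrite negbK => /eqP ->; rewrite mxE.
  rewrite mxE; apply: eq_bigr => l _.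
  have -> : (G *m x^T) l 0 = \sum_m G l m * x^T m 0 by rewrite mxE.
  rewrite mulr_sumr; apply: eq_bigr => m _.
  by rewrite [G _ _]mxE [x^T _ _]mxE !mulrA.
have xE l : a%:~R * d j * (l == i)%:R = b%:~R * d i * (phi 0 l)%:~R.
  move/rowP/(_ l)/eqP: x0; rewrite !mxE eqxx subr_eq0 => /eqP.
  by case: (l == i).
have b0 : b != 0.
  apply: contraNneq a0 => b0; have := xE i; rewrite b0 eqxx !mul0r mulr1 => /eqP.
  by rewrite mulf_eq0 (negbTE (dn0 j)) orbF intr_eq0.
have phiE : phi = phi 0 i *: eps i.
  apply/rowP=> l; rewrite [RHS]mxE [eps i _ _]mxE eqxx /=; case: eqP => [->|/eqP li]; first by rewrite mulr1.
  rewrite mulr0; have /esym/eqP := xE l; rewrite (negbTE li) mulr0.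
  by rewrite !mulf_eq0 intr_eq0 (negbTE b0) (negbTE (dn0 i)) intr_eq0 => /eqP.
set c := phi 0 i in phiE.
have c1 : c * v i j = 1.
  have : phi *m v = eps j by rewrite /phi mulmxKV.
  by rewrite phiE -scalemxAl -rowE => /rowP/(_ j); rewrite !mxE !eqxx.
have cc : c * c = 1.
  have : c = 1 \/ c = -1.
    by have /eqP := congr1 absz c1; rewrite abszM muln_eq1 => /andP[/eqP h _]; lia.
  by case=> ->.
(* A coroot pairs to 2 with its own functional; comparing entries at [i] will force [d j = d i]. *)
have beta_i : (v *m alpha j) i 0 = 2 * c.
  have : phi *m (v *m alpha j) = 2%:M.
    rewrite mulmxA /phi mulmxKV // -rowE; apply/rowP=> l; by rewrite !mxE ord1 diag.
  rewrite phiE -scalemxAl -rowE => /matrixP/(_ 0 0); rewrite mxE [row _ _ _ _]mxE [in RHS]mxE eqxx mulr1n => h.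
  by rewrite -[2 * c]mulrC -h mulrA cc mul1r.
have beta : v *m alpha j = c *: alpha i.
  have QE : d j *: Q _ _ (v *m alpha j) = (c%:~R * d i) *: Q _ _ (alpha i).
    rewrite -Gphi phiE /Q map_mxZ linearZ /= -scalemxAr -/(Q _ _ (eps i)) Galpha scalerA.
    by rewrite mulrC.
  have dd : d j = d i.
    have /matrixP/(_ i 0) := QE; rewrite mxE [Q _ _ _ _ _]mxE beta_i [RHS]mxE [Q _ _ _ _ _]mxE mxE diag.
    have c0 : c%:~R != 0 :> rat by rewrite intr_eq0; apply: contra_eq_neq cc => ->; rewrite mul0r.
    rewrite rmorphM /= => h; apply: (mulIf c0); apply: (mulIf (_ : 2%:~R != 0 :> rat)) => //.
    by rewrite -!mulrA ![c%:~R * _]mulrC mulrA in h *; rewrite h; ring.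
  apply/colP=> l; have /matrixP/(_ l 0) := QE; rewrite mxE [Q _ _ _ _ _]mxE [RHS]mxE [Q _ _ _ _ _]mxE dd.
  rewrite mulrAC mulrC => /(mulIf (dn0 i)) h; apply/eqP; rewrite -(eqr_int rat) h.
  by rewrite [(c *: alpha i) l 0]mxE rmorphM.
split.
  have : (c == 1) || (c == -1).
    by rewrite -sqrf_eq1 expr2 cc.
  by rewrite beta; case/orP => /eqP ->; [left; rewrite scale1r|right; rewrite scaleN1r].
rewrite srefE mulmxBr mulmx1 mulmxBl mulmxV // mulmxA -mulmxA -/phi phiE beta.
by rewrite -scalemxAl -scalemxAr scalerA cc scale1r srefE.
Qed.

End Weyl.

(** * Demazure operators on GKM functions *)

Section Demazure.
Variables (k : fieldType) (n : nat) (A : 'M[int]_n).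
Hypothesis hA : is_finite_cartan A.
Implicit Types (i j : 'I_n) (v w : 'M[int]_n) (a b r q : ps k n) (f g : 'M[int]_n -> ps k n).
Local Notation s := (sref A).
Local Notation E := (@ps_e k n).
Local Notation alpha := (alpha A).

Definition ps_dvd a b := exists q, b = a * q.

Lemma ps_dvdD a b r : ps_dvd a b -> ps_dvd a r -> ps_dvd a (b + r).
Proof. by move=> [x ->] [y ->]; exists (x + y); rewrite mulrDr. Qed.

Lemma ps_dvdM a b r : ps_dvd a b -> ps_dvd a (r * b).
Proof. by move=> [x ->]; exists (r * x); rewrite mulrCA. Qed.

Lemma ps_dvdB a b r : ps_dvd a b -> ps_dvd a r -> ps_dvd a (b - r).
Proof. by move=> [x ->] [y ->]; exists (x - y); rewrite mulrBr. Qed.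

Lemma ps_dvdN (v : 'cV[int]_n) b : ps_dvd (1 - E (- v)) b -> ps_dvd (1 - E v) b.
Proof. by move=> [x ->]; exists (- E (- v) * x); rewrite ps_1Be_opp mulrA [_ * - _]mulrC. Qed.

Lemma ps_dvd_act w (v : 'cV[int]_n) b : ps_dvd (1 - E v) b -> ps_dvd (1 - E (w *m v)) (ps_act w b).
Proof. by move=> [x ->]; exists (ps_act w x); rewrite rmorphM rmorphB rmorph1 /= act_ps_e. Qed.

(** The default 0 keeps [dem] total; the value is meaningful only under a divisibility such as those
    established in [demE] and [demrE]. *)
Definition ps_div b a : ps k n :=
  if pselect (ps_dvd a b) is left h then sval (cid h) else 0.

Lemma ps_divP a b : ps_dvd a b -> a * ps_div b a = b.
Proof. by rewrite /ps_div => h; case: pselect => // h'; case: (cid h') => x. Qed.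

Local Notation X i := (E (- alpha i)).

Lemma dem_denom_reg i a b : (1 - X i) * a = (1 - X i) * b -> a = b.
Proof.
move/eqP; rewrite -subr_eq0 -mulrBr => /eqP/ps_1Be_reg h; apply/eqP; rewrite -subr_eq0.
by apply/eqP/h; rewrite oppr_eq0; apply: alpha_neq0.
Qed.

Lemma sref_dvd i r : ps_dvd (1 - X i) (r - ps_act (s i) r).
Proof.
have [q ->] := @act_dvd k n (s i) i r (sref_varpi A (i := i)).
exists (E (varpi i) * q).
have -> : s i *m varpi i = varpi i - alpha i by rewrite sref_mul !mxE !eqxx scale1r.
by rewrite ps_eD -{1}[E (varpi i)]mulr1 -mulrBr mulrAC mulrC mulrA.
Qed.

Lemma refl_dvd v i r : in_W A v ->
  ps_dvd (1 - E (v *m alpha i)) (r - ps_act (v *m s i *m invmx v) r).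
Proof.
move=> Wv; have uv := in_W_unit hA Wv.
have := ps_dvd_act v (sref_dvd i (ps_act (invmx v) r)).
rewrite rmorphB /= !act_mul mulmxV // act_1 mulmxN => /ps_dvdN.
by rewrite -!mulmxA.
Qed.

Definition gkm f := forall w, in_W A w -> forall v, in_W A v -> forall i,
  ps_dvd (1 - E (v *m alpha i)) (f w - f (w *m (v *m s i *m invmx v))).

Definition dem i f : 'M[int]_n -> ps k n :=
  fun w => ps_div (f w - X i * ps_act (s i) (f (w *m s i))) (1 - X i).

Definition demr i a := ps_div (a - X i * ps_act (s i) a) (1 - X i).

Lemma demE i f w : gkm f -> in_W A w ->
  (1 - X i) * dem i f w = f w - X i * ps_act (s i) (f (w *m s i)).
Proof.
move=> gf Ww; apply: ps_divP; set y := f (w *m s i).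
(* The first part is divisible by the congruence at [w] for [alpha i], the second because [s i] acts
   trivially modulo [1 - X i]. *)
have -> : f w - X i * ps_act (s i) y = (f w - y) + (y - ps_act (s i) y) + (1 - X i) * ps_act (s i) y.
  ring.
apply: ps_dvdD; last by exists (ps_act (s i) y).
apply: ps_dvdD; last exact: sref_dvd.
have := gf _ Ww _ (in_W1 A) i; rewrite mul1mx mul1mx invmx1 mulmx1 -/y => h.
by apply: ps_dvdN; rewrite opprK.
Qed.

Lemma demrE i a : (1 - X i) * demr i a = a - X i * ps_act (s i) a.
Proof.
apply: ps_divP; have -> : a - X i * ps_act (s i) a = (a - ps_act (s i) a) + (1 - X i) * ps_act (s i) a.
  ring.
by apply: ps_dvdD; [exact: sref_dvd|exists (ps_act (s i) a)].
Qed.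

(** On constant functions [dem] restricts to [demr], so idempotence, braid relations and product
    rules for [demr] are special cases of those for [dem]. *)
Lemma gkm_cst a : gkm (fun _ => a).
Proof. by move=> w _ v _ i; rewrite subrr; exists 0; rewrite mulr0. Qed.

Lemma dem_cst i a : dem i (fun _ => a) = (fun _ => demr i a).
Proof. by []. Qed.

Lemma act_dem_denom i : ps_act (s i) (X i) = E (alpha i).
Proof. by rewrite act_ps_e mulmxN sref_alpha // opprK. Qed.

Lemma act_srefK i a : ps_act (s i) (ps_act (s i) a) = a.
Proof. by rewrite act_mul srefK // act_1. Qed.

(** Twisting by [s i], in the argument and in the value, multiplies both numerator and denominator
    of D_i f by [- E (alpha i)]. Idempotence follows, since D_i is the identity on functions with
    this symmetry. *)
Lemma dem_inv i f w : gkm f -> in_W A w -> ps_act (s i) (dem i f (w *m s i)) = dem i f w.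
Proof.
move=> gf Ww; have Wws := in_W_mul Ww (in_W_sref A i).
apply: (@dem_denom_reg i); rewrite demE //.
have := congr1 (ps_act (s i)) (demE i gf Wws).
rewrite rmorphM !rmorphB rmorphM rmorph1 /= act_dem_denom act_srefK -mulmxA srefK // mulmx1.
set y := ps_act _ (dem _ _ _); set z := ps_act _ _ => h.
have XE : X i * E (alpha i) = 1 := ps_eNl _ _.
transitivity (- X i * ((1 - E (alpha i)) * y)); first by rewrite -{1}XE; ring.
rewrite h (_ : - X i * _ = X i * E (alpha i) * f w - X i * z); last by ring.
by rewrite XE mul1r.
Qed.

(** If the coroot of a congruence is not proportional to [alpha i], coprimality cancels the
    denominator. If it is, the reflection is [s i] itself and [dem_inv] turns the difference into
    one of the form r - s_i r, up to sign. *)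
Lemma gkm_dem i f : gkm f -> gkm (dem i f).
Proof.
move=> gf w Ww v Wv j; set t := v *m s j *m invmx v.
have Wt : in_W A t by apply: (in_W_refl hA).
have Wwt := in_W_mul Ww Wt; have Wws := in_W_mul Ww (in_W_sref A i).
case: (pselect (exists a b : int, a != 0 /\ a *: alpha i = b *: (v *m alpha j))).
  move=> [a [b [a0 e]]]; have [be te] := coroot_dichotomy hA Wv a0 e.
  have h : ps_dvd (1 - X i) (dem i f w - dem i f (w *m t)).
    have := sref_dvd i (dem i f (w *m s i)); rewrite dem_inv // /t te.
    by move=> [q e']; exists (- q); rewrite mulrN -e' opprB.
  by case: be => ->; [apply: ps_dvdN|].
move=> indep.
have [q qE] : ps_dvd (1 - E (v *m alpha j)) ((1 - X i) * (dem i f w - dem i f (w *m t))).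
  rewrite mulrBr !demE //.
  have -> : forall x y z u, x - X i * y - (z - X i * u) = (x - z) - X i * (y - u) by move=> *; ring.
  apply: ps_dvdB; first exact: gf.
  apply: ps_dvdM; rewrite -rmorphB.
  have Wsv := in_W_mul (in_W_sref A i) Wv.
  have := gf _ Wws _ Wsv j; set t' := _ *m s j *m invmx _.
  have -> : w *m s i *m t' = w *m t *m s i.
    have us := in_W_unit hA (in_W_sref A i); have uv := in_W_unit hA Wv.
    have usv := in_W_unit hA Wsv.
    have e1 : t' *m (s i *m v) = s i *m v *m s j by rewrite /t' mulmxKV.
    have tv : t *m v = v *m s j by rewrite /t mulmxKV.
    have e2 t0 : t0 *m v = v *m s j -> t' = s i *m t0 *m s i.
      move=> t0v; rewrite -[LHS](mulmxK usv) e1 -[RHS](mulmxK usv); congr (_ *m _).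
      by rewrite -!mulmxA [s i *m (s i *m v)]mulmxA srefK // mul1mx t0v.
    by rewrite (e2 t tv) !mulmxA -[w *m s i *m s i]mulmxA srefK // mulmx1.
  by move/(ps_dvd_act (s i)); rewrite mulmxA mulmxA srefK // mul1mx.
have [] := @ps_1Be_coprime k n (- alpha i) (v *m alpha j) _ _ (coroot_neq0 hA j Wv) _ qE.
  move=> a b e; apply/eqP; apply: contra_notT indep => a0.
  by exists a, (- b); split=> //; rewrite scaleNr -e scalerN opprK.
by move=> r rE; exists r.
Qed.

Lemma dem_ext i f g : (forall w, in_W A w -> f w = g w) -> forall w, in_W A w -> dem i f w = dem i g w.
Proof. by move=> fg w Ww; rewrite /dem !fg //; apply: in_W_mul => //; apply: in_W_sref. Qed.

Lemma dem_idem i f w : gkm f -> in_W A w -> dem i (dem i f) w = dem i f w.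
Proof.
move=> gf Ww; apply: (@dem_denom_reg i); rewrite demE ?dem_inv //; last exact: gkm_dem.
by rewrite mulrBl mul1r.
Qed.

Lemma demr_idem i a : demr i (demr i a) = demr i a.
Proof. exact: (dem_idem i (gkm_cst a) (in_W1 A)). Qed.

End Demazure.

(** * Braid relations *)

(* (c, (a, b)) encodes the monomial c e^{a alpha_i + b alpha_j}, (b, l) the alternating word of
   length l in s_i, s_j with first letter s_i iff b. As D_i = (1 + s_i) / (1 - e^{-alpha_i}), a product of
   D_i's and D_j's times theta = prod_(beta > 0) (1 - e^{-beta}) is sum_u C_u u with Laurent polynomials
   C_u; multiplying by D_c on the right changes C_u to (C_u + C_{u s_c}) / (1 - e^{- u alpha_c}). *)
Definition lpoly := seq (int * (int * int)).
Definition dihedral := (bool * nat)%type.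
Definition lcomb := seq (dihedral * lpoly).

Definition lcoef (x : int * int) (P : lpoly) : int :=
  foldr (fun t acc => if t.2 == x then t.1 + acc else acc) 0 P.
Definition lpoly_eq (P Q : lpoly) :=
  all (fun x => lcoef x P == lcoef x Q) (undup (map snd (P ++ Q))).
Definition lmonom (c : int) (x : int * int) (P : lpoly) : lpoly :=
  [seq (c * t.1, (t.2.1 + x.1, t.2.2 + x.2)) | t <- P].
Definition lmul1B (x : int * int) (P : lpoly) : lpoly := P ++ lmonom (-1) (- x.1, - x.2) P.
Definition lmerge (P : lpoly) : lpoly :=
  [seq t <- [seq (lcoef x P, x) | x <- undup (map snd P)] | t.1 != 0].

(* Long division by 1 - e^{-x}, eliminating the monomials that are highest in the direction x *)
Fixpoint ldiv_rec (fuel : nat) (x : int * int) (P Q : lpoly) : lpoly :=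
  if fuel is fuel'.+1 then
    if P is t0 :: P' then
      let l (y : int * int) := y.1 * x.1 + y.2 * x.2 in
      let t := foldr (fun t acc => if l acc.2 < l t.2 then t else acc) t0 P' in
      ldiv_rec fuel' x (lmerge (P ++ lmul1B x [:: (- t.1, t.2)])) (t :: Q)
    else Q
  else Q.
(** The quotient is trusted nowhere: [lcheck] multiplies it back. The fuel 300 only has to suffice
    in the cases that are run. *)
Definition ldiv x P := ldiv_rec 300 x (lmerge P) [::].

Section Rank2.
Variables (r q : int) (m : nat).

Fixpoint dword (b : bool) (l : nat) : seq bool := if l is l'.+1 then b :: dword (~~ b) l' else [::].
Definition refl2 (c : bool) (x : int * int) : int * int :=
  if c then (- x.1 - q * x.2, x.2) else (x.1, - x.2 - r * x.1).
Definition simple2 (c : bool) : int * int := if c then (1, 0) else (0, 1).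
Definition dihedral_act (u : dihedral) x := foldr refl2 x (dword u.1 u.2).
Definition dlast (u : dihedral) := if odd u.2 then u.1 else ~~ u.1.
(** The identity and the longest element are the ones named by two alternating words; the flag
    [true] is chosen for both. *)
Definition dnorm (u : dihedral) : dihedral :=
  if (u.2 == 0%N) || (u.2 == m) then (true, u.2) else u.
Definition drmul (c : bool) (u : dihedral) : dihedral :=
  if u.2 == 0%N then (c, 1%N) else if dlast u == c then dnorm (u.1, u.2.-1)
  else if u.2 == m then dnorm (~~ u.1, u.2.-1) else dnorm (u.1, u.2.+1).
(** By [dem_inv] only the coset of [u] modulo s_c matters once D_c has been applied. Coefficients
    are gathered at its shorter element before the division, as they need not be divisible
    separately. *)
Definition drepr (c : bool) (u : dihedral) : dihedral :=
  if ((drmul c u).2 < u.2)%N then drmul c u else u.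

Definition lcollect (f : dihedral -> dihedral) (u : dihedral) (C : lcomb) : lpoly :=
  flatten [seq t.2 | t <- C & f t.1 == u].
Definition lreps c (C : lcomb) := undup [seq drepr c t.1 | t <- C].
Definition lquot c C u := ldiv (dihedral_act u (simple2 c)) (lcollect (drepr c) u C).
Definition lstep c (C : lcomb) : lcomb :=
  flatten [seq (let Q := lquot c C u in let x := dihedral_act u (simple2 c) in
     [:: (u, Q); (drmul c u, lmonom (-1) (- x.1, - x.2) Q)]) | u <- lreps c C].
Definition lcheck c (C : lcomb) :=
  all (fun t : dihedral * lpoly => (t.1.2 <= m)%N) C &&
  all (fun u : dihedral => (u.2 <= m)%N && lpoly_eq (lmul1B (dihedral_act u (simple2 c)) (lquot c C u))
      (lcollect (drepr c) u C)) (lreps c C).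
Fixpoint lrun (w : seq bool) (C : lcomb) : option lcomb :=
  if w is c :: w' then if lcheck c C then lrun w' (lstep c C) else None else Some C.

Definition droots : seq (int * int) :=
  let orbit c := [seq dihedral_act (b, l) (simple2 c) | b <- [:: true; false], l <- iota 0 m] in
  undup [seq x <- orbit true ++ orbit false | (0 <= x.1) && (0 <= x.2)].
Definition ltheta : lpoly := foldr lmul1B [:: (1, (0, 0))] droots.
Definition lcomb_eq (C D : lcomb) :=
  all (fun u => lpoly_eq (lcollect id u C) (lcollect id u D)) (undup (map fst (C ++ D))).
(** The first test says that the entries of each root at [i] and [j] do not both vanish, so that
    theta is a product of nonzerodivisors and can be cancelled in the end. *)
Definition braid_check :=
  [&& all (fun x : int * int => (2 * x.1 + q * x.2 != 0) || (r * x.1 + 2 * x.2 != 0)) droots &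
   if lrun (dword true m) [:: ((true, 0%N), ltheta)] is Some C then
   if lrun (dword false m) [:: ((true, 0%N), ltheta)] is Some D then lcomb_eq C D else false else false].
End Rank2.

(** * Soundness of the symbolic computation *)

Section Braid.
Variables (k : fieldType) (n : nat) (A : 'M[int]_n).
Hypothesis hA : is_finite_cartan A.
Variables (i j : 'I_n) (m : nat).
Local Notation s := (sref A).
Local Notation E := (@ps_e k n).
Local Notation alpha := (alpha A).
Local Notation r := (A i j).
Local Notation q := (A j i).
Local Notation dact := (dihedral_act r q).

Definition vec2 (x : int * int) := x.1 *: alpha i + x.2 *: alpha j.
Definition lev (P : lpoly) : ps k n := \sum_(t <- P) t.1%:~R * E (vec2 t.2).
Definition letter2 c := if c then i else j.
Definition mat2 (u : dihedral) : 'M[int]_n :=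
  foldr (fun c acc => s (letter2 c) *m acc) 1%:M (dword u.1 u.2).
Hypothesis mat2m : mat2 (true, m) = mat2 (false, m).

Lemma vec2D x y : vec2 (x.1 + y.1, x.2 + y.2) = vec2 x + vec2 y.
Proof. by rewrite /vec2 /= !scalerDl addrACA. Qed.

Lemma vec2N x : vec2 (- x.1, - x.2) = - vec2 x.
Proof. by rewrite /vec2 /= !scaleNr opprD. Qed.

Lemma lcoefE x P : lcoef x P = \sum_(t <- P | t.2 == x) t.1.
Proof. by elim: P => [|t P IH]; rewrite ?big_nil // big_cons /= IH. Qed.

Lemma lev_coef P K : uniq K -> {subset [seq t.2 | t <- P] <= K} ->
  lev P = \sum_(x <- K) (lcoef x P)%:~R * E (vec2 x).
Proof.
move=> uK PK.
have H x : (lcoef x P)%:~R * E (vec2 x) = \sum_(t <- P | t.2 == x) t.1%:~R * E (vec2 t.2).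
  by rewrite lcoefE rmorph_sum mulr_suml; apply: eq_bigr => t /eqP <-.
rewrite (eq_bigr _ (fun x _ => H x)) (exchange_big_dep predT) //= /lev big_seq [RHS]big_seq; apply: eq_bigr => t tP.
rewrite (eq_bigl (pred1 t.2)) => [|x]; last by rewrite eq_sym.
by rewrite big_seq_pred1 //; apply/PK/map_f.
Qed.

Lemma lev_eq P Q : lpoly_eq P Q -> lev P = lev Q.
Proof.
move=> /allP h; set K := undup (map snd (P ++ Q)) in h.
rewrite (lev_coef (K := K)) ?undup_uniq // => [|x]; last first.
  by rewrite mem_undup map_cat mem_cat => ->.
rewrite [RHS](lev_coef (K := K)) ?undup_uniq // => [|x]; last first.
  by rewrite mem_undup map_cat mem_cat orbC => ->.
by rewrite big_seq [RHS]big_seq; apply: eq_bigr => x /h/eqP ->.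
Qed.

Lemma lev_cat P Q : lev (P ++ Q) = lev P + lev Q.
Proof. exact: big_cat. Qed.

Lemma lev_monom c x P : lev (lmonom c x P) = c%:~R * E (vec2 x) * lev P.
Proof.
rewrite /lev /lmonom big_map mulr_sumr; apply: eq_bigr => t _ /=.
by rewrite vec2D ps_eD rmorphM /=; ring.
Qed.

Lemma lev_mul1B x P : lev (lmul1B x P) = (1 - E (- vec2 x)) * lev P.
Proof. by rewrite lev_cat lev_monom vec2N mulrBl mul1r mulN1r mulNr. Qed.

Lemma vec2_refl c x : s (letter2 c) *m vec2 x = vec2 (refl2 r q c x).
Proof.
rewrite sref_mul /vec2 /refl2 /letter2; case: c => /=; rewrite !mxE cartan_diag //.
  rewrite addrAC -scalerBl; congr (_ *: _ + _); ring.
rewrite -addrA -scalerBl; congr (_ + _ *: _); ring.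
Qed.

Lemma mat2_vec u x : mat2 u *m vec2 x = vec2 (dact u x).
Proof.
rewrite /mat2 /dihedral_act; elim: (dword _ _) => [|c t IH] /=; first by rewrite mul1mx.
by rewrite -mulmxA IH vec2_refl.
Qed.

Lemma vec2_simple c : vec2 (simple2 c) = alpha (letter2 c).
Proof. by case: c; rewrite /vec2 /= scale1r scale0r ?addr0 ?add0r. Qed.

Lemma mat2_W u : in_W A (mat2 u).
Proof. by exists (map letter2 (dword u.1 u.2)); rewrite /mat2 foldr_map. Qed.

Lemma mat2_rcons b l : mat2 (b, l.+1) = mat2 (b, l) *m s (letter2 (dlast (b, l.+1))).
Proof.
rewrite /mat2 /dlast /=; elim: l b => [|l IH] b /=; first by rewrite mulmx1 mul1mx.
by rewrite [in LHS](IH (~~ b)) /= mulmxA negbK; case: (odd l).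
Qed.

Lemma dlastS b l : dlast (b, l.+1) = if l == 0%N then b else ~~ dlast (b, l).
Proof. by rewrite /dlast /=; case: l => //= l; rewrite negbK; case: (odd l); rewrite ?negbK. Qed.

Lemma mat2_norm u : mat2 (dnorm m u) = mat2 u.
Proof.
case: u => b l; rewrite /dnorm /=; case: eqP => [->|_] //=; case: eqP => [->|_] //=.
by case: b.
Qed.

Lemma mat2_rmul c u : (u.2 <= m)%N -> mat2 (drmul m c u) = mat2 u *m s (letter2 c).
Proof.
have down b l : dlast (b, l.+1) = c -> mat2 (b, l) = mat2 (b, l.+1) *m s (letter2 c).
  by move=> e; rewrite mat2_rcons e -mulmxA srefK // mulmx1.
case: u => b [|l] /= lm; first by rewrite /drmul /= /mat2 /= mulmx1 mul1mx.
rewrite /drmul /=; case: eqP => [e|/eqP e]; first by rewrite mat2_norm down.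
have ec : ~~ dlast (b, l.+1) = c by move: e; case: (dlast _) c {down} => [] [].
case: eqP => [em|_]; last by rewrite mat2_norm mat2_rcons dlastS /= ec.
rewrite mat2_norm down; last by rewrite -ec /dlast /=; case: (odd l); rewrite ?negbK.
by congr (_ *m _); rewrite em; case: (b); rewrite /= mat2m.
Qed.

Variable w : 'M[int]_n.
Hypothesis Ww : in_W A w.
Definition feval u (g : 'M[int]_n -> ps k n) : ps k n := ps_act (mat2 u) (g (w *m mat2 u)).

Lemma feval_inv c u g : gkm A g -> (u.2 <= m)%N ->
  feval (drmul m c u) (dem A (letter2 c) g) = feval u (dem A (letter2 c) g).
Proof.
move=> gg um; rewrite /feval mat2_rmul // -act_mul mulmxA dem_inv //.
by apply: in_W_mul => //; apply: mat2_W.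
Qed.

Lemma feval_repr c u g : gkm A g -> (u.2 <= m)%N ->
  feval (drepr m c u) (dem A (letter2 c) g) = feval u (dem A (letter2 c) g).
Proof. by move=> gg um; rewrite /drepr; case: ifP => // _; apply: feval_inv. Qed.

Lemma feval_dem c u g : gkm A g -> (u.2 <= m)%N ->
  (1 - E (- vec2 (dact u (simple2 c)))) * feval u (dem A (letter2 c) g) =
  feval u g - E (- vec2 (dact u (simple2 c))) * feval (drmul m c u) g.
Proof.
move=> gg um; rewrite /feval mat2_rmul //.
have Wu : in_W A (w *m mat2 u) by apply: in_W_mul => //; apply: mat2_W.
have := congr1 (ps_act (mat2 u)) (demE (letter2 c) gg Wu).
rewrite rmorphM !rmorphB rmorphM rmorph1 /= !act_ps_e act_mul.
by rewrite mulmxN -(vec2_simple c) mat2_vec mulmxA.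
Qed.

Definition lsum (C : lcomb) g := \sum_(t <- C) lev t.2 * feval t.1 g.

Lemma lsum_collect (f : dihedral -> dihedral) (G : dihedral -> ps k n) (C : lcomb) K :
  uniq K -> {subset [seq f t.1 | t <- C] <= K} ->
  \sum_(t <- C) lev t.2 * G (f t.1) = \sum_(u <- K) lev (lcollect f u C) * G u.
Proof.
move=> uK CK.
have evc u : lev (lcollect f u C) = \sum_(t <- C | f t.1 == u) lev t.2.
  rewrite /lcollect; elim: (C) => [|t D IH]; first by rewrite big_nil /lev big_nil.
  by rewrite big_cons /=; case: eqP => _ //=; rewrite lev_cat IH.
have H u : lev (lcollect f u C) * G u = \sum_(t <- C | f t.1 == u) lev t.2 * G (f t.1).
  by rewrite evc mulr_suml; apply: eq_bigr => t /eqP <-.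
rewrite [RHS](eq_bigr _ (fun u _ => H u)) (exchange_big_dep predT) //= big_seq [RHS]big_seq; apply: eq_bigr => t tC.
rewrite (eq_bigl (pred1 (f t.1))) => [|x]; last by rewrite eq_sym.
by rewrite big_seq_pred1 //; apply/CK/(map_f (fun t => f t.1)).
Qed.

Lemma lsum_step c C g : gkm A g -> lcheck r q m c C ->
  lsum C (dem A (letter2 c) g) = lsum (lstep r q m c C) g.
Proof.
move=> gg /andP[/allP Cm /allP chk].
have -> : lsum C (dem A (letter2 c) g) =
    \sum_(t <- C) lev t.2 * feval (drepr m c t.1) (dem A (letter2 c) g).
  by rewrite /lsum big_seq [RHS]big_seq; apply: eq_bigr => t /Cm tm; rewrite feval_repr.
rewrite (lsum_collect (K := lreps m c C) (f := drepr m c) (fun u => feval u (dem A (letter2 c) g)));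
  rewrite ?undup_uniq //; last by move=> u; rewrite mem_undup.
rewrite /lsum /lstep big_flatten big_map big_seq [RHS]big_seq; apply: eq_bigr => u /chk/andP[um /lev_eq <-].
rewrite /= !big_cons big_nil /= addr0 lev_mul1B lev_monom vec2N mulrAC feval_dem //.
by ring.
Qed.

Lemma lsum_run t C D g : gkm A g -> lrun r q m t C = Some D ->
  lsum C (dwords (@dem k n A) (map letter2 t) g) = lsum D g.
Proof.
move=> gg; elim: t C => [|c t IH] C /=; first by case=> ->.
case: ifP => // chk /IH <-; apply: lsum_step => //.
by apply: (dwords_stable (V := gkm A)) => // x f; apply: (gkm_dem hA).
Qed.

Lemma lsum_eq C D g : lcomb_eq C D -> lsum C g = lsum D g.
Proof.
move=> /allP h; set K := undup (map fst (C ++ D)) in h.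
rewrite /lsum (lsum_collect (K := K) (f := id) (fun u => feval u g)) ?undup_uniq // => [|u]; last first.
  by rewrite mem_undup map_cat mem_cat => ->.
rewrite [RHS](lsum_collect (K := K) (f := id) (fun u => feval u g)) ?undup_uniq // => [|u]; last first.
  by rewrite mem_undup map_cat mem_cat orbC => ->.
by rewrite big_seq [RHS]big_seq; apply: eq_bigr => u /h/lev_eq ->.
Qed.

Lemma braid_of_check g : gkm A g -> braid_check r q m ->
  dwords (@dem k n A) (map letter2 (dword true m)) g w = dwords (@dem k n A) (map letter2 (dword false m)) g w.
Proof.
move=> gg /andP[/allP rts].
case e1 : lrun => [C|//]; case e2 : lrun => [D|//] CD.
have := etrans (lsum_run gg e1) (etrans (lsum_eq g CD) (esym (lsum_run gg e2))).
rewrite /lsum !big_seq1 /= /feval /mat2 /= mulmx1 !act_1.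
set y := dwords _ _ _ _; set z := dwords _ _ _ _; rewrite /ltheta => /eqP.
rewrite -subr_eq0 -mulrBr => /eqP h; apply/eqP; rewrite -subr_eq0; apply/eqP.
elim: (droots _ _ _) rts h => [|x t IH] rts /=.
  by rewrite /lev big_seq1 /vec2 /= !scale0r addr0 ps_e0 mulr1 mul1r.
rewrite lev_mul1B -mulrA => /ps_1Be_reg h; apply: IH => [u ut|]; first by apply: rts; rewrite inE ut orbT.
apply: h; rewrite oppr_eq0; apply: contraTneq (rts x (mem_head _ _)) => v0.
have /colP/(_ i) := v0; have /colP/(_ j) := v0; rewrite !mxE !cartan_diag // => hj hi.
have -> : 2 * x.1 + q * x.2 = 0 by rewrite -[RHS]hi; ring.
have -> : r * x.1 + 2 * x.2 = 0 by rewrite -[RHS]hj; ring.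
by rewrite eqxx.
Qed.

End Braid.

(** Four integers recording how a dihedral element differs from the identity, see [mat2_gram]. They
    depend on two Cartan integers only, so an identity between matrices of any size becomes a finite
    computation. *)
Definition gram2 := (int * int * int * int)%type.
Definition gram2_step (r q : int) (c : bool) (N : gram2) : gram2 :=
  let: (a, b, d, e) := N in
  if c then (- 1 - a - q * d, - b - q * e, d, e) else (a, b, - d - r * a, - 1 - e - r * b).
Definition gram2_word r q t := foldr (gram2_step r q) (0, 0, 0, 0) t.

Section Braid2.
Variables (k : fieldType) (n : nat) (A : 'M[int]_n).
Hypothesis hA : is_finite_cartan A.
Local Notation alpha := (alpha A).

Lemma mat2_gram (i j : 'I_n) u : let: (a, b, d, e) := gram2_word (A i j) (A j i) (dword u.1 u.2) in
  mat2 A i j u = 1%:M + alpha i *m (a *: delta_mx 0 i + b *: delta_mx 0 j)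
                      + alpha j *m (d *: delta_mx 0 i + e *: delta_mx 0 j).
Proof.
rewrite /mat2; elim: (dword _ _) => [|c t IH] /=.
  by rewrite !scale0r !addr0 !mulmx0 !addr0.
case: (gram2_word _ _ t) IH => [[[a b] d] e] /= ->.
have sij x y z : sref A x *m (alpha y *m z) = alpha y *m z - alpha x *m (A y x *: z).
  by rewrite mulmxA sref_mul mxE mulmxBl -scalemxAl scalemxAr.
case: c => /=; rewrite !mulmxDr mulmx1 !sij {1}srefE !cartan_diag //; apply/matrixP=> x y;
  rewrite !mxE !big_ord1 !mxE; ring.
Qed.

Lemma mat2_braid (i j : 'I_n) : i != j ->
  let m := coxeter_exp (A i j) (A j i) in mat2 A i j (true, m) = mat2 A i j (false, m).
Proof.
move=> ij m; have := mat2_gram i j (true, m); have := mat2_gram i j (false, m); rewrite /m.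
move: (cartan_rank2 hA ij); rewrite !inE.
by do ![case/orP]; case/eqP => -> -> /= -> ->.
Qed.

Lemma map_letter2 (i j : 'I_n) m :
  map (letter2 i j) (dword true m) = altw i j m /\ map (letter2 i j) (dword false m) = altw j i m.
Proof. by elim: m => //= m [IH1 IH2]; rewrite IH1 IH2. Qed.

Lemma dem_braid (i j : 'I_n) g w : i != j -> gkm A g -> in_W A w ->
  let m := coxeter_exp (A i j) (A j i) in
  dwords (@dem k n A) (altw i j m) g w = dwords (@dem k n A) (altw j i m) g w.
Proof.
move=> ij gg Ww m; have [<- <-] := map_letter2 i j m.
apply: (braid_of_check hA (mat2_braid ij) Ww gg).
rewrite /m; move: (cartan_rank2 hA ij); rewrite !inE.
by do ![case/orP]; case/eqP => -> ->; vm_compute.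
Qed.

Lemma demr_braid (i j : 'I_n) a : i != j ->
  let m := coxeter_exp (A i j) (A j i) in
  dwords (@demr k n A) (altw i j m) a = dwords (@demr k n A) (altw j i m) a.
Proof.
move=> ij m; have cst t : dwords (@dem k n A) t (fun _ => a) = fun _ => dwords (@demr k n A) t a.
  by elim: t => //= c t ->.
by have := dem_braid ij (@gkm_cst k n A a) (in_W1 A); rewrite /= !cst.
Qed.

End Braid2.

(** * The image and the kernel of tau *)

Section Tau.
Variables (k : fieldType) (n : nat) (A : 'M[int]_n).
Hypothesis hA : is_finite_cartan A.
Implicit Types (i j : 'I_n) (v w : 'M[int]_n) (a b r : ps k n) (f g : 'M[int]_n -> ps k n).
Implicit Types (L : seq (ps k n * ps k n)).
Local Notation s := (sref A).
Local Notation E := (@ps_e k n).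
Local Notation alpha := (alpha A).
Local Notation X i := (E (- alpha i)).
Local Notation dem := (@dem k n A).
Local Notation demr := (@demr k n A).

Lemma tauE L w : tau L w = \sum_(x <- L) x.1 * ps_act (invmx w) x.2.
Proof. by elim: L => [|x L IH]; rewrite ?big_nil // big_cons -IH. Qed.

Definition map_left (phi : ps k n -> ps k n) L := [seq (phi x.1, x.2) | x <- L].

Lemma tau_mul a L w : tau (map_left ( *%R a) L) w = a * tau L w.
Proof. by rewrite !tauE big_map mulr_sumr; apply: eq_bigr => x _; rewrite mulrA. Qed.

Lemma tau_cat L L' w : tau (L ++ L') w = tau L w + tau L' w.
Proof. by rewrite !tauE big_cat. Qed.

Lemma invmx_sref w i : in_W A w -> invmx (w *m s i) = s i *m invmx w.
Proof.
move=> Ww; have uw := in_W_unit hA Ww; have uws := in_W_unit hA (in_W_mul Ww (in_W_sref A i)).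
have e : w *m s i *m (s i *m invmx w) = 1%:M.
  by rewrite mulmxA -[w *m s i *m s i]mulmxA srefK // mulmx1 mulmxV.
by rewrite -[RHS](mulKmx uws) e mulmx1.
Qed.

(** The inverse of [w *m s i] is [s i *m invmx w], so the outer [s i] cancels on the second factors
    and only the first factors feel the operator. *)
Lemma tau_demr i L w : in_W A w ->
  (1 - X i) * tau (map_left (demr i) L) w = tau L w - X i * ps_act (s i) (tau L (w *m s i)).
Proof.
move=> Ww; rewrite !tauE big_map rmorph_sum !mulr_sumr -sumrB; apply: eq_bigr => x _ /=.
rewrite mulrA demrE rmorphM /= act_mul invmx_sref // mulmxA srefK // mul1mx.
by rewrite mulrBl mulrA.
Qed.

Lemma tau_gkm L : gkm A (tau L).
Proof.
move=> w Ww v Wv i; rewrite !tauE -sumrB; set t := v *m s i *m invmx v.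
have Wt : in_W A t by apply: (in_W_refl hA).
have ut := in_W_unit hA Wt; have uw := in_W_unit hA Ww; have uv := in_W_unit hA Wv.
have tt : t *m t = 1%:M.
  rewrite /t !mulmxA mulmxKV // -[v *m s i *m s i]mulmxA srefK // mulmx1 mulmxV //.
have -> : invmx (w *m t) = t *m invmx w.
  have uwt := in_W_unit hA (in_W_mul Ww Wt).
  have e : w *m t *m (t *m invmx w) = 1%:M.
    by rewrite mulmxA -[w *m t *m t]mulmxA tt mulmx1 mulmxV.
  by rewrite -[RHS](mulKmx uwt) e mulmx1.
elim/big_ind: _ => [|x y|x _]; first by exists 0; rewrite mulr0.
  exact: ps_dvdD.
by rewrite -mulrBr -act_mul; apply/ps_dvdM/(refl_dvd hA).
Qed.

Definition eq_on_W f g := forall w, in_W A w -> f w = g w.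
Definition eq_mod_im f g := exists L, forall w, in_W A w -> f w - g w = tau L w.

Lemma eq_on_W_mod_im f g : eq_on_W f g -> eq_mod_im f g.
Proof. by move=> fg; exists [::] => w Ww; rewrite fg // subrr. Qed.

(** Stated for the raw quotient, which unfolds both from [dem] of the multiplied function and, for
    constant [f], from [demr]. *)
Lemma dem_mul0 (l : 'cV[int]_n) i f w : l i 0 = 0 -> gkm A f -> in_W A w ->
  (1 - X i) * ps_div (E l * f w - X i * ps_act (s i) (E l * f (w *m s i))) (1 - X i) =
  (1 - X i) * (E l * dem i f w).
Proof.
move=> l0 gf Ww; have sl : s i *m l = l by rewrite sref_mul l0 scale0r subr0.
have e : E l * f w - X i * ps_act (s i) (E l * f (w *m s i)) = (1 - X i) * (E l * dem i f w).
  by rewrite mulrCA demE // rmorphM /= act_ps_e sl; ring.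
by rewrite ps_divP e //; exists (E l * dem i f w).
Qed.

Lemma dem_mul1 (l : 'cV[int]_n) i f w : l i 0 = 1 -> gkm A f -> in_W A w ->
  (1 - X i) * ps_div (E l * f w - X i * ps_act (s i) (E l * f (w *m s i))) (1 - X i) =
  (1 - X i) * (E (l - alpha i) * dem i f w + E l * f w).
Proof.
move=> l1 gf Ww; have sl : s i *m l = l - alpha i by rewrite sref_mul l1 scale1r.
have e : E l * f w - X i * ps_act (s i) (E l * f (w *m s i)) =
    (1 - X i) * (E (l - alpha i) * dem i f w + E l * f w).
  rewrite mulrDr [(1 - X i) * (E (l - alpha i) * _)]mulrCA demE // rmorphM /= act_ps_e sl ps_eD; ring.
by rewrite ps_divP e //; exists (E (l - alpha i) * dem i f w + E l * f w).
Qed.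

Lemma demr_mul0 (l : 'cV[int]_n) i a : l i 0 = 0 -> demr i (E l * a) = E l * demr i a.
Proof.
by move=> l0; apply: (@dem_denom_reg k n A hA i); apply: (dem_mul0 l0 (@gkm_cst k n A a) (in_W1 A)).
Qed.

Lemma demr_mul1 (l : 'cV[int]_n) i a : l i 0 = 1 ->
  demr i (E l * a) = E (l - alpha i) * demr i a + E l * a.
Proof.
by move=> l0; apply: (@dem_denom_reg k n A hA i); apply: (dem_mul1 l0 (@gkm_cst k n A a) (in_W1 A)).
Qed.

(** Since e^{-alpha_i} is a unit, D_i f = f amounts to f(w s_i) = s_i f(w), which propagates along a
    word. The right-hand side is the image under [tau] of 1 tensor f(1). *)
Lemma fixed_act f : (forall i, eq_on_W (dem i f) f) -> gkm A f ->
  forall w, in_W A w -> f w = ps_act (invmx w) (f 1%:M).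
Proof.
move=> fixf gf.
have step i w : in_W A w -> f (w *m s i) = ps_act (s i) (f w).
  move=> Ww; have := demE i gf Ww; rewrite fixf // mulrBl mul1r => /addrI/oppr_inj h.
  have := congr1 ( *%R (E (alpha i))) h; rewrite !mulrA ps_eNr !mul1r => ->.
  by rewrite act_srefK.
move=> w [t ->]; have : forall w', in_W A w' ->
   f (w' *m foldr (fun i acc => s i *m acc) 1%:M t) =
   ps_act (invmx (foldr (fun i acc => s i *m acc) 1%:M t)) (f w').
  elim: t => [|i t IH] w' Ww' /=; first by rewrite mulmx1 invmx1 act_1.
  have Wt : in_W A (foldr (fun i acc => s i *m acc) 1%:M t) by exists t.
  rewrite mulmxA IH; last by apply: in_W_mul => //; apply: in_W_sref.
  rewrite step // act_mul; congr ps_act.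
  have ut := in_W_unit hA Wt; have us := in_W_unit hA (in_W_sref A i).
  have ust : s i *m foldr (fun i acc => s i *m acc) 1%:M t \in unitmx by rewrite unitmx_mul us.
  rewrite -[LHS](mulmxK ust) mulmxA -[invmx _ *m s i *m s i]mulmxA srefK // mulmx1.
  by rewrite mulVmx // mul1mx.
by move/(_ _ (in_W1 A)); rewrite mul1mx.
Qed.

Theorem gkm_image f : gkm A f -> exists L, forall w, in_W A w -> f w = tau L w.
Proof.
move=> gf; suff [L hL] : eq_mod_im f (fun _ => 0) by exists L => w /hL; rewrite subr0.
apply: (@hecke_vanishing n A hA _ (gkm A) eq_on_W dem _ _ _ _ _ _ _ eq_mod_im _ (fun l g w => E l * g w)) => //.
- by move=> i g; apply: (gkm_dem hA).
- by move=> g h gh w Ww; rewrite gh.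
- by move=> x y z xy yz w Ww; rewrite xy ?yz.
- by move=> i g h _ _; apply: dem_ext.
- by move=> i g gg w Ww; apply: (dem_idem hA).
- by move=> i j g ij gg w Ww; apply: (dem_braid hA).
- move=> x y [L hL]; exists (map_left ( *%R (-1)) L) => w Ww.
  by rewrite tau_mul -hL // mulN1r opprB.
- move=> x y z [L hL] [L' hL']; exists (L ++ L') => w Ww.
  by rewrite tau_cat -hL // -hL' // addrA subrK.
- exact: eq_on_W_mod_im.
- move=> i x y gx gy [L hL]; exists (map_left (demr i) L) => w Ww.
  apply: (@dem_denom_reg k n A hA i); rewrite tau_demr // mulrBr !demE // -!hL //; last first.
    by apply: in_W_mul => //; apply: in_W_sref.
  by rewrite rmorphB /=; ring.
- move=> l x gx w Ww v Wv i; rewrite -mulrBr; apply: ps_dvdM; exact: gx.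
- move=> l x [L hL]; exists (map_left ( *%R (E l)) L) => w Ww.
  by rewrite tau_mul -hL // !subr0.
- move=> l x y [L hL]; exists (map_left ( *%R (E l)) L) => w Ww.
  by rewrite tau_mul -hL // mulrBr.
- by move=> l x; apply: eq_on_W_mod_im => w _; rewrite mulrA ps_eNl mul1r.
- move=> l i x l0 gx; apply: eq_on_W_mod_im => w Ww; apply: (@dem_denom_reg k n A hA i); exact: dem_mul0.
- move=> l i x l1 gx [L hL]; exists (map_left ( *%R (E (l - alpha i))) L) => w Ww.
  rewrite tau_mul -hL // subr0; apply/eqP; rewrite subr_eq; apply/eqP.
  apply: (@dem_denom_reg k n A hA i); exact: dem_mul1.
move=> x gx fx; exists [:: (1, x 1%:M)] => w Ww.
by rewrite subr0 tauE big_seq1 mul1r; apply: fixed_act.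
Qed.

Definition tensor_eq L L' := forall (V : zmodType) (beta : ps k n -> ps k n -> V), balanced A beta ->
  \sum_(x <- L) beta x.1 x.2 = \sum_(x <- L') beta x.1 x.2.

(** An operator on first factors that is linear over the invariants descends to tensors, because
    precomposition with it preserves balanced maps; no tensor product has to be constructed. *)
Lemma balanced_map (V : zmodType) (beta : ps k n -> ps k n -> V) (phi : ps k n -> ps k n) : balanced A beta ->
  {morph phi : a b / a + b} -> (forall a r, Defs.invariant A r -> phi (a * r) = phi a * r) ->
  balanced A (fun a b => beta (phi a) b).
Proof.
move=> [b1 b2 b3] phiD phiM; split=> [a a' b|a b b'|a r b inv_r].
- by rewrite [ps_add a a'](_ : _ = a + a') // phiD b1.
- exact: b2.
- by rewrite [ps_mul a r](_ : _ = a * r) // phiM // b3.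
Qed.

Lemma demrD i : {morph demr i : a b / a + b}.
Proof.
move=> a b; apply: (@dem_denom_reg k n A hA i); rewrite mulrDr !demrE rmorphD /=; ring.
Qed.

Lemma demrM i a r : Defs.invariant A r -> demr i (a * r) = demr i a * r.
Proof.
move=> inv_r; apply: (@dem_denom_reg k n A hA i); rewrite mulrA !demrE rmorphM /= (inv_r (s i)); first ring.
exact: in_W_sref.
Qed.

Lemma tensor_eq_map L L' (phi : ps k n -> ps k n) : {morph phi : a b / a + b} ->
  (forall a r, Defs.invariant A r -> phi (a * r) = phi a * r) -> tensor_eq L L' ->
  tensor_eq (map_left phi L) (map_left phi L').
Proof.
move=> phiD phiM LL' V beta bal; rewrite !big_map.
exact: (LL' _ _ (balanced_map bal phiD phiM)).
Qed.

Lemma tensor_eq_mul a L L' : tensor_eq L L' -> tensor_eq (map_left ( *%R a) L) (map_left ( *%R a) L').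
Proof. by apply: tensor_eq_map => [x y|x r _]; rewrite ?mulrDr ?mulrA. Qed.

Lemma fixed_invariant a : (forall i, demr i a = a) -> Defs.invariant A a.
Proof.
move=> ha w Ww; have uw := in_W_unit hA Ww.
have fixa i : eq_on_W (dem i (fun _ => a)) (fun _ => a) by move=> ? _; rewrite dem_cst ha.
have := fixed_act fixa (@gkm_cst k n A a) (in_W_inv hA Ww).
by rewrite invmxK => <-.
Qed.

Theorem tau_injective L : (forall w, in_W A w -> tau L w = 0) -> tensor_eq L [::].
Proof.
move=> hL; pose V0 L := forall w, in_W A w -> tau L w = 0.
apply: (@hecke_vanishing n A hA _ V0 eq (fun i => map_left (demr i)) _ _ _ _ _ _ _ tensor_eq _
  (fun l => map_left ( *%R (E l)))) => //.
- move=> i x hx w Ww; apply: (@dem_denom_reg k n A hA i); rewrite tau_demr // !hx //; first by rewrite rmorph0 !mulr0 subr0.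
  by apply: in_W_mul => //; apply: in_W_sref.
- by move=> x y z -> ->.
- by move=> i x y _ _ ->.
- move=> i x _; rewrite /map_left -map_comp; apply: eq_map => y /=; by rewrite (demr_idem hA).
- move=> i j x ij _.
  have DsE t : dwords (fun i => map_left (demr i)) t x = map_left (dwords demr t) x.
    elim: t => [|c t IH] /=; first by rewrite /map_left -[LHS]map_id; apply: eq_map; case.
    by rewrite IH /map_left -map_comp.
  by rewrite !DsE; apply: eq_map => y; rewrite (demr_braid hA _ ij).
- by move=> x y h V beta bal; rewrite h.
- by move=> x y z h h' V beta bal; rewrite h // h'.
- by move=> x y -> V beta bal.
- by move=> i x y _ _; apply: tensor_eq_map; [exact: demrD|exact: demrM].
- by move=> l x hx w Ww; rewrite tau_mul hx ?mulr0.
- by move=> l x; apply: tensor_eq_mul.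
- by move=> l x y; apply: tensor_eq_mul.
- move=> l x V beta bal; rewrite !big_map /=; apply: eq_bigr => y _.
  by rewrite mulrA ps_eNl mul1r.
- move=> l i x l0 _ V beta bal; rewrite !big_map /=; apply: eq_bigr => y _.
  by rewrite demr_mul0.
- move=> l i x l1 _ hx V beta bal; rewrite !big_map /=.
  have := tensor_eq_mul (E (l - alpha i)) hx bal; rewrite /= !big_map big_nil => h.
  apply: etrans (etrans (congr2 +%R h erefl) (add0r _)); rewrite -big_split /=.
  by apply: eq_bigr => y _; rewrite demr_mul1 //; case: bal => <-.
move=> x hx fx V beta bal; rewrite big_nil.
have inv_x y : y \in x -> Defs.invariant A y.1.
  move=> yx; apply: fixed_invariant => i.
  move: (fx i) yx; rewrite /map_left => e; elim: (x) e => // z t IH [e1 e2].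
  by rewrite inE => /orP[/eqP ->|/(IH e2)//]; apply: (congr1 fst e1).
have bal2 := bal; case: bal => [b1 b2 b3].
have b0 a : beta a 0 = 0.
  by apply: (@addIr _ (beta a 0)); rewrite add0r -b2; congr beta; apply: (@addr0 (ps k n)).
(* The first factors are invariant and cross the tensor sign; the remaining sum is the value of
   [tau] at the identity. *)
transitivity (beta 1 (\sum_(y <- x) y.1 * y.2)).
  rewrite (big_morph (beta 1) (b2 1) (b0 1)) big_seq [RHS]big_seq; apply: eq_bigr => y /inv_x iy.
  by rewrite -[y.1 in LHS]mul1r; apply: b3.
have := hx _ (in_W1 A); rewrite tauE invmx1.
by under eq_bigr do rewrite act_1; move=> ->.
Qed.

End Tau.

Theorem mainTheorem6 (k : fieldType) (n : nat) (A : 'M[int]_n)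
  (hA : is_finite_cartan A) :
  (forall L : seq (ps k n * ps k n),
     (forall w, in_W A w -> tau L w = @ps_const k n 0) -> tensor_zero A L)
  /\
  (forall f : 'M[int]_n -> ps k n,
     (exists L : seq (ps k n * ps k n), forall w, in_W A w -> f w = tau L w)
     <->
     (forall w, in_W A w -> forall v, in_W A v -> forall i : 'I_n,
        ps_cong (f w) (f (w *m (v *m sref A i *m invmx v)))
                (ps_sub (@ps_const k n 1) (ps_exp k (coroot A v i))))).
Proof.
split=> [L hL V beta bal|f].
  by have := tau_injective hA hL bal; rewrite big_nil.
have corootE v i : ps_exp k (coroot A v i) = ps_e k (v *m alpha A i).
  rewrite /ps_e; congr ps_exp; apply/funext=> j; rewrite mxE.
  by apply: eq_bigr => l _; rewrite mxE.
split=> [[L hL] w Ww v Wv i|h].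
  have Wt : in_W A (w *m (v *m sref A i *m invmx v)).
    by apply: in_W_mul => //; apply: (in_W_refl hA).
  by rewrite corootE hL // hL //; apply: (tau_gkm hA).
apply: (gkm_image hA) => w Ww v Wv i.
by have := h _ Ww _ Wv i; rewrite corootE.
Qed.
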